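(* There exist an absolute constant $C>0$ and a randomized online edge-coloring algorithm with the following guarantee. For all integers $n\ge 2$ and $\Delta\ge 1$, and for every $n$-vertex graph $G$ of maximum degree $\Delta$ together with an arrival order of its edges, both fixed in advance (oblivious adversary), the algorithm (given $n$ and $\Delta$ in advance) outputs a proper edge coloring of $G$ which, with high probability in $n$ (i.e., with probability at least $1-1/n^{c}$ for some absolute constant $c>0$), uses at most $$\Delta + C\,\Delta^{15/16}(\ln n)^{1/32}$$ distinct colors.
   Context: Online edge coloring: an unknown graph $G=(V,E)$ with $|V|=n$ and maximum degree $\Delta$ is given to the algorithm via $V$ and $\Delta$ in advance; edges are revealed one at a time, and upon arrival each edge must be immediately and irrevocably assigned a color so that edges sharing an endpoint receive distinct colors. An oblivious adversary fixes the graph and the arrival order in advance, independently of the algorithm's random choices; the probability is over the algorithm's internal randomness. *)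

(* Defs.v *)
From HB Require Import structures.
From mathcomp Require Import all_boot all_order all_algebra.
From mathcomp Require Import all_classical all_reals all_analysis.

Set Implicit Arguments.
Unset Strict Implicit.
Unset Printing Implicit Defensive.

Import Order.TTheory GRing.Theory Num.Theory.

(* A simple graph on the vertex set 'I_n is given by its edge set, an edge
   being an unordered pair of distinct vertices. *)
Definition simple_graph (n : nat) (E : {set {set 'I_n}}) : Prop :=
  forall e, e \in E -> #|e| = 2.

Definition degree (n : nat) (E : {set {set 'I_n}}) (v : 'I_n) : nat :=
  #|[set e in E | v \in e]|.

Definition max_degree (n : nat) (E : {set {set 'I_n}}) : nat :=
  \max_(v : 'I_n) degree E v.

Definition proper_edge_coloring (n : nat) (E : {set {set 'I_n}})
    (col : {set 'I_n} -> nat) : Prop :=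
  forall (e f : {set 'I_n}) (v : 'I_n), e \in E -> f \in E -> e != f ->
    v \in e -> v \in f -> col e <> col f.

Definition nb_colors (n : nat) (E : {set {set 'I_n}})
    (col : {set 'I_n} -> nat) : nat :=
  size (undup [seq col e | e <- enum E]).

Definition arrival_order (n : nat) (E : {set {set 'I_n}})
    (s : seq {set 'I_n}) : Prop :=
  uniq s /\ s =i E.

(* A randomized online algorithm that knows n and Delta from the start is a
   random deterministic one: a seed is drawn, and the color of an arriving edge
   e is a function [choose_color h e] of the sequence h of edges revealed before
   e (in order of arrival), of e, and of the seed.  The colors given earlier are
   themselves determined by h and the seed, so they need not be passed.
   Measurability in the seed makes every event about the colors of finitely many
   edges measurable, so that its probability is meaningful. *)
Record online_algorithm (R : realType) (n Delta : nat) := OnlineAlgorithm {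
  seed_display : measure_display ;
  seed : measurableType seed_display ;
  seed_law : probability seed R ;
  choose_color : seq {set 'I_n} -> {set 'I_n} -> seed -> nat ;
  choose_color_measurable :
    forall h e, measurable_fun setT (choose_color h e)
}.

(* The coloring output on the arrival sequence s, for a given seed; for e in s,
   [take (index e s) s] is the part of s that precedes e. *)
Definition output (R : realType) (n Delta : nat)
    (A : online_algorithm R n Delta) (s : seq {set 'I_n}) (w : seed A) :
    {set 'I_n} -> nat :=
  fun e => choose_color (take (index e s) s) e w.

(* Main.v *)
Require Import Defs.
From HB Require Import structures.
From mathcomp Require Import all_boot all_order all_algebra.
From mathcomp Require Import all_classical all_reals all_analysis.
From mathcomp Require Import ring lra zify.

Set Implicit Arguments.
Unset Strict Implicit.
Unset Printing Implicit Defensive.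

Import Order.TTheory GRing.Theory Num.Theory.
Local Open Scope ring_scope.

(* Each color c has at each vertex v a weight x_(v,c), initially 1. When the edge
   uv arrives, it receives the color c with probability
   q_c = x_(u,c) x_(v,c) / W, where W is the sum of these products; x_(u,c) and
   x_(v,c) drop to 0 and, for d <> c, x_(u,d) and x_(v,d) are divided by 1 - q_d,
   so that all weights are martingales. An edge with W < (1 + eps / 2) Delta is
   left to a greedy coloring with fresh colors, and a color is no longer offered
   at a vertex where its weight exceeds 8 / eps.

   Fix v with neighbors u_1, ..., u_d in order of arrival, and let A_(i,c) be the
   weight of c at u_i when v u_i arrives. These numbers have mean 1, and with
   probability 1 - exp(- eps^15 Delta^2 / C) their sum over any "staircase" of
   pairs (i,c) is that of the all-ones matrix up to eps^7 Delta^2: there are only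
   exp(O(Delta log Delta)) staircases. The exponent is quadratic in Delta, which
   is what allows Delta to be as small as a power of eps^-1 times sqrt (ln n).

   The rest is deterministic. While c is free at v, 1 / x_(v,c) equals
   1 - sum_j A_(j,c) / W_j, hence is close to r = 1 - sum_j 1 / W_j for most c;
   so W_i is close to (number of free colors) / r for most i. This keeps the latter
   quotient close to the size (1 + eps) Delta of the palette, so that few edges
   at v are left to the greedy coloring. *)

(** * One step of the weight process *)

Section OneStep.
Variable R : realType.
Implicit Types (x y z w q : R).

(** With [u = y / 2 <= 1/8], the inequality [1 - u <= expR (- u)] gives [expR y <= (1 - u)^-2], and
    [(1 - u)^2 (1 + 2u + 4u^2) = 1 + u^2 (1 - 6u + 4u^2) >= 1]. *)
Lemma expR_le_quadratic y : y <= 4^-1 -> expR y <= 1 + y + y ^+ 2.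
Proof.
move=> y_le; have h := expR_ge1Dx (- (y / 2)).
have -> : y = y / 2 + y / 2 by field.
set u := y / 2 in h *; have u_le : u <= 8^-1 by rewrite /u; lra.
have e_gt0 := expR_gt0 (- u); rewrite expRD -[u in expR u]opprK expRN.
set E := expR (- u) in h e_gt0 *.
rewrite -invfM -[leLHS]mul1r ler_pdivrMr ?mulr_gt0//.
have : (1 - u) * (1 - u) <= E * E by apply: ler_pM; lra.
have : 0 <= u ^+ 2 by exact: sqr_ge0.
have : 0 <= u ^+ 2 * (8^-1 - u) by rewrite mulr_ge0 ?sqr_ge0//; lra.
nra.
Qed.

(* The correction [- 16 w] makes [expR (z - 16 w)] a supermartingale when the
   state is sent to [0] with probability [q] and scaled by [(1 - q)^-1]
   otherwise. With [d] and [y] the exponents before and after scaling, it is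
   enough that [q * expR (- y) <= q + d - y]. *)
Lemma expR_scaling_step q z w : 0 <= q <= 2^-1 -> z ^+ 2 <= 2 * w ->
    w <= 512^-1 ->
  q + (1 - q) * expR (z / (1 - q) - 16 * (w / (1 - q) ^+ 2))
    <= expR (z - 16 * w).
Proof.
move=> /andP[q0 q1] zw w_le; have q2 : 0 < 1 - q by lra.
set s := (1 - q)^-1; have s1 : s * (1 - q) = 1 by rewrite mulVf; lra.
have s_ge1 : 1 <= s by nra.
have s_le2 : s <= 2 by nra.
have w0 : 0 <= w by have := sqr_ge0 z; lra.
have -> : z / (1 - q) - 16 * (w / (1 - q) ^+ 2) = s * z - 16 * (s ^+ 2 * w).
  by rewrite /s; field; lra.
set v := s ^+ 2 * w; set Z := s * z.
have Zv : Z ^+ 2 <= 2 * v by have := ler_wpM2l (sqr_ge0 s) zw; rewrite /Z /v exprMn; lra.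
have v0 : 0 <= v by rewrite /v mulr_ge0// sqr_ge0.
have v_le : v <= 128^-1.
  have : s ^+ 2 <= 4 by rewrite expr2; nra.
  by rewrite /v; nra.
have Z_le : `|Z| <= 8^-1.
  rewrite -(@ler_pXn2r _ 2) ?nnegrE ?normr_ge0 ?invr_ge0//.
  have -> : (8^-1 : R) ^+ 2 = 64^-1 by field.
  by rewrite -normrX ger0_norm ?sqr_ge0//; lra.
have /andP[Zl Zu] : - 8^-1 <= Z <= 8^-1 by rewrite -ler_norml.
set y := Z - 16 * v.
have ey : expR (- y) <= 1 - y + y ^+ 2.
  by rewrite -[y ^+ 2]sqrrN; apply: expR_le_quadratic; rewrite /y; lra.
have y2 : y ^+ 2 <= 8 * v.
  rewrite /y; have -> : (Z - 16 * v) ^+ 2 = Z ^+ 2 - 32 * (Z * v) + 256 * v ^+ 2 by ring.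
  have : - (Z * v) <= 8^-1 * v by rewrite -mulNr ler_wpM2r//; lra.
  have : v ^+ 2 <= 128^-1 * v by rewrite expr2 ler_wpM2r.
  lra.
(* After division by [q] this reads [expR (- y) <= 1 - Z + 16 v (2 - q)]. As [- y = 16 v - Z], it
   remains to see that [y^2 <= 16 v (1 - q)], which follows from [y2] and [q <= 1/2]. *)
have main : q * expR (- y) <= q + (z - 16 * w) - y.
  have -> : q + (z - 16 * w) - y = q * (1 - Z + 16 * v * (2 - q)).
    rewrite /y /Z /v.
    have -> : s = (1 - q)^-1 by [].
    by field; lra.
  apply: ler_wpM2l => //; apply: le_trans ey _.
  have : 0 <= v * (2^-1 - q) by apply: mulr_ge0 => //; lra.
  rewrite /y; nra.
set d := z - 16 * w in main *.
have -> : expR d = expR y * expR (d - y) by rewrite -expRD addrC subrK.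
have h1 := expR_ge1Dx (d - y); have ey0 := expR_gt0 y.
apply: le_trans (ler_wpM2l (ltW ey0) h1).
have := ler_wpM2r (ltW ey0) main.
rewrite -mulrA [expR (- y) * _]mulrC expRxMexpNx_1; lra.
Qed.

(** Weierstrass's product inequality. In the induction the cross term [t i * (P - 1)], with [P] the
    product of the other factors, is nonnegative because both factors have the same sign. *)
Lemma prod_ge1Dsum (I : Type) (r : seq I) (t : I -> R) :
  (forall i, -1 <= t i <= 0) \/ (forall i, 0 <= t i) ->
  1 + \sum_(i <- r) t i <= \prod_(i <- r) (1 + t i).
Proof.
case=> ht; elim: r => [|i r IH]; rewrite ?(big_nil, big_cons) ?addr0//.
- have P0 : 0 <= \prod_(j <- r) (1 + t j) <= 1.
    elim: (r) => [|j r' /andP[IH0 IH1]]; rewrite ?(big_nil, big_cons) ?ler01 ?lexx//.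
    by have /andP[? ?] := ht j; apply/andP; split; nra.
  by have /andP[? ?] := ht i; case/andP: P0 => ? ?; nra.
- have P0 : 1 <= \prod_(j <- r) (1 + t j).
    elim: (r) => [|j r' IH']; rewrite ?(big_nil, big_cons) ?lexx//.
    by have := ht j; nra.
  by have := ht i; nra.
Qed.

(* Negative correlation of disjoint events: exactly one [c] is chosen, with law
   [q], and [c] contributes the factor [1] if it is chosen and [U c] otherwise. *)
Lemma sum_prod_exclusive (C : finType) (q U V : C -> R) :
    (forall c, 0 <= q c) -> \sum_c q c = 1 -> (forall c, 0 < U c) ->
    (forall c, U c <= 1) \/ (forall c, 1 <= U c) ->
    (forall c, q c + (1 - q c) * U c <= V c) ->
  \sum_c q c * \prod_(d | d != c) U d <= \prod_c V c.
Proof.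
move=> q0 q1 U0 Ut UV.
have q_le1 c : q c <= 1.
  by rewrite -q1 (bigD1 c)//= lerDl; apply: sumr_ge0.
(* [1 + t c] is the mean factor of [c] divided by [U c]. The left side is thus
   [\prod U * (1 + \sum t)], and [\prod (U * (1 + t))] dominates it by the product inequality. *)
pose t c := q c * ((U c)^-1 - 1).
have tE c : U c * (1 + t c) = q c + (1 - q c) * U c.
  by rewrite /t; field; apply: lt0r_neq0.
have -> : \sum_c q c * \prod_(d | d != c) U d = \prod_c U c * (1 + \sum_c t c).
  transitivity (\prod_c U c * \sum_c q c / U c).
    rewrite mulr_sumr; apply: eq_bigr => c _; rewrite [\prod_c0 U c0](bigD1 c)//=.
    by field; exact: lt0r_neq0.
  congr (_ * _); rewrite -q1 -big_split/=; apply: eq_bigr => c _.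
  by rewrite /t; field; exact: lt0r_neq0.
have tS : (forall c, -1 <= t c <= 0) \/ (forall c, 0 <= t c).
  case: Ut => hU; [right|left] => c.
    by rewrite /t mulr_ge0// subr_ge0 invf_ge1.
  have : (U c)^-1 <= 1 by rewrite invf_le1.
  have : 0 < (U c)^-1 by rewrite invr_gt0.
  by rewrite /t; have := q0 c; have := q_le1 c; nra.
apply: (@le_trans _ _ (\prod_c (U c * (1 + t c)))).
  rewrite big_split/= ler_wpM2l//; first by apply: prodr_ge0 => c _; exact: ltW.
  exact: prod_ge1Dsum.
apply: ler_prod => c _; rewrite tE UV andbT.
by rewrite addr_ge0// mulr_ge0 ?subr_ge0// ltW.
Qed.

End OneStep.

(** * Deterministic dynamics at a vertex *)

Lemma sum_nat_recr (V : nmodType) (P : pred nat) (F : nat -> V) i :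
  \sum_(0 <= j < i.+1 | P j) F j =
  \sum_(0 <= j < i | P j) F j + (if P i then F i else 0).
Proof. by rewrite big_mkcond big_nat_recr//= -big_mkcond. Qed.

(** Keep the terms with [b i >= 0], raise their weights to [M], and use the bound for this one
    subset. *)
Lemma weighted_sum_le (R : realDomainType) (I : Type) (s : seq I) (P : pred I)
    (b w : I -> R) (M delta : R) :
    0 <= M -> (forall i, P i -> 0 <= w i <= M) ->
    (forall S : pred I, \sum_(i <- s | P i && S i) b i <= delta) ->
  \sum_(i <- s | P i) w i * b i <= M * delta.
Proof.
move=> M0 wM hS.
apply: (@le_trans _ _ (\sum_(i <- s | P i && (0 <= b i)) M * b i)).
  rewrite big_mkcondr/=; apply: ler_sum => i /wM /andP[w0 w1].
  by case: ifP => [b0|/negbT]; [rewrite ler_wpM2r|rewrite -ltNge => /ltW b0; nra].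
by rewrite -mulr_sumr ler_wpM2l.
Qed.

Lemma norm_sum_le_split (R : realDomainType) (I : Type) (s : seq I) (P : pred I)
    (b : I -> R) (delta : R) :
    (forall S : pred I, `|\sum_(i <- s | P i && S i) b i| <= delta) ->
  \sum_(i <- s | P i) `|b i| <= 2 * delta.
Proof.
move=> hS; rewrite (bigID (fun i => 0 <= b i))/= mulr_natl mulr2n.
apply: lerD.
  rewrite (eq_bigr b); last by move=> i /andP[_ ?]; rewrite ger0_norm.
  exact: le_trans (ler_norm _) (hS _).
rewrite (eq_bigr (fun i => - b i)); last first.
  by move=> i /andP[_]; rewrite -ltNge => /ltW ?; rewrite ler0_norm.
rewrite sumrN; apply: le_trans (hS (fun i => ~~ (0 <= b i))).
by rewrite -normrN ler_norm.
Qed.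

Section VertexDynamics.
Variables (R : realType) (N m : nat) (B th : R).
(** For the vertex [v] under study: [act i] says that the [i]-th edge is at [v], [ok i] that the
    weight process colors it, and [k i] is the color drawn. [x i c] and [A i c] are the weights of
    [c] just before, at [v] and at the other end. *)
Variables (act ok : nat -> bool) (x A : nat -> 'I_N -> R) (k : nat -> 'I_N).

(* A weight above [B] counts as [0]: the color is no longer offered. *)
Definition cap (t : R) : R := if t <= B then t else 0.

(** The model is the set of colors free at [v], which only shrinks with time; a set of colors
    independent of time is another case. *)
Definition staircase (P : nat -> pred 'I_N) : Prop :=
  forall c i j, (i <= j)%N -> act i -> act j -> P j c -> P i c.

(** The arbitrary set [S] of steps is what lets this bound pass to weighted sums over the steps and
    to sums of absolute values. *)
Definition disc_le (M : nat -> 'I_N -> R) (delta : R) : Prop :=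
  forall (S : pred nat) (P : nat -> pred 'I_N), staircase P ->
  `|\sum_(0 <= i < m | act i && S i) \sum_(c | P i c) (M i c - 1)| <= delta.

Let a i c := cap (A i c).
Let W i := \sum_c cap (x i c) * a i c.
Let q i c := cap (x i c) * a i c / W i.
Let sc i := act i && ok i.

Hypothesis B_gt0 : 0 < B.
Hypothesis B_th : 2 * B ^+ 2 <= th.
Hypothesis x0 : forall c, x 0 c = 1.
Hypothesis A_ge0 : forall i c, 0 <= A i c.
Hypothesis x_idle : forall i, (i < m)%N -> ~~ sc i -> x i.+1 =1 x i.
Hypothesis W_succ : forall i, (i < m)%N -> sc i -> th <= W i.
Hypothesis k_succ : forall i, (i < m)%N -> sc i ->
  0 < cap (x i (k i)) * a i (k i).
Hypothesis x_succ : forall i, (i < m)%N -> sc i ->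
  forall c, x i.+1 c = if c == k i then 0 else x i c / (1 - q i c).

Let th_gt0 : 0 < th.
Proof. by apply: lt_le_trans B_th; rewrite mulr_gt0// exprn_gt0. Qed.

Lemma cap_ge0 t : 0 <= t -> 0 <= cap t.
Proof. by rewrite /cap; case: ifP. Qed.

Lemma cap_leB t : cap t <= B.
Proof. by rewrite /cap; case: ifP => // _; rewrite ltW. Qed.

Lemma cap_le t : 0 <= t -> cap t <= t.
Proof. by rewrite /cap; case: ifP. Qed.

Let a_ge0 i c : 0 <= a i c. Proof. exact: cap_ge0. Qed.

Let q_bound i c : (i < m)%N -> sc i -> 0 <= x i c -> 0 <= q i c <= 2^-1.
Proof.
move=> im si xi; have Wi := W_succ im si; have W0 := lt_le_trans th_gt0 Wi.
have c0 := cap_ge0 xi; have c1 := cap_leB (x i c); have a1 := cap_leB (A i c).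
apply/andP; split; first by rewrite /q divr_ge0 ?mulr_ge0 ?(ltW W0).
rewrite /q ler_pdivrMr//.
have : cap (x i c) * a i c <= B * B by apply: ler_pM.
by have := B_th; rewrite expr2; move: (cap _ * _) (B * B) (W i) Wi => t1 t2 t3; lra.
Qed.

Lemma x_ge0 i c : (i <= m)%N -> 0 <= x i c.
Proof.
elim: i => [_|i IH im]; first by rewrite x0.
have xi := IH (ltnW im); case: (boolP (sc i)) => si; last by rewrite x_idle.
rewrite (x_succ im si); case: ifP => // _.
by have /andP[? ?] := q_bound im si xi; rewrite divr_ge0//; lra.
Qed.

Let x_step i c : (i < m)%N -> 0 < x i.+1 c -> 0 < x i c <= x i.+1 c.
Proof.
move=> im; case: (boolP (sc i)) => si; last by rewrite x_idle// => ->/=.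
have xi := x_ge0 c (ltnW im).
rewrite (x_succ im si); case: ifP => [_|_ h]; first by rewrite ltxx.
have /andP[q0 q1] := q_bound im si xi.
have x_gt0 : 0 < x i c.
  by rewrite lt_neqAle xi andbT; apply: contraTneq h => <-; rewrite mul0r ltxx.
by rewrite x_gt0/= ler_pdivlMr; nra.
Qed.

Lemma x_gt0_anti i j c : (i <= j)%N -> (j <= m)%N -> 0 < x j c -> 0 < x i c.
Proof.
move=> ij; elim: j ij => [|j IH]; first by rewrite leqn0 => /eqP ->.
rewrite leq_eqVlt => /predU1P[-> //|ij jm xj].
by apply: IH => //; [exact: ltnW|have /andP[] := x_step jm xj].
Qed.

(** A division of [x] by [1 - q] lowers [1 / x] by [q / x], which is at most [A / W <= A / th].
    Capping only makes this smaller, so the bound also holds for weights above [B]. *)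
Lemma inv_x_ge i c : (i <= m)%N -> 0 < x i c ->
  1 - \sum_(0 <= j < i | act j) A j c / th <= (x i c)^-1.
Proof.
elim: i => [_|i IH im xi1]; first by rewrite big_geq// x0 invr1 subr0.
have /andP[xi xix] := x_step im xi1; have IHi := IH (ltnW im) xi.
rewrite sum_nat_recr; case: (boolP (sc i)) => si; last first.
  rewrite x_idle// opprD addrA; apply: le_trans IHi.
  rewrite gerDl oppr_le0; by case: ifP => // _; rewrite divr_ge0// ltW.
have /andP[ai _] := si; rewrite ai.
move: xi1; rewrite (x_succ im si); case: ifP => [_|_ _]; first by rewrite ltxx.
have /andP[q0 q1] := q_bound im si (ltW xi).
have W0 := lt_le_trans th_gt0 (W_succ im si).
have : q i c <= A i c / th * x i c.
  have -> : q i c = a i c / W i * cap (x i c) by rewrite /q mulrAC mulrC mulrA mulrAC.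
  have c0 : 0 <= cap (x i c) by apply: cap_ge0; exact: ltW.
  apply: ler_pM => //; first by rewrite divr_ge0// ltW.
    by apply: ler_pM; rewrite ?invr_ge0 ?cap_le// ?(ltW W0)// lef_pV2 ?posrE ?W_succ.
  exact: cap_le (ltW xi).
rewrite invf_div; move: IHi; set t := A i c / th => IHi qt.
have : (1 - q i c) / x i c = (x i c)^-1 - q i c / x i c by field; exact: lt0r_neq0.
have : q i c / x i c <= t by rewrite ler_pdivrMr.
lra.
Qed.

(** If the weight of [c] exceeds [8 / eps], then by [inv_x_ge] the [A j c] sum to at least
    [(1 - eps / 8) th >= (1 + eps / 4) D], over at most [D] steps. Each such color thus adds
    [eps / 4 * D] to the discrepancy of a rectangle. *)
Lemma card_frozen (eps D delta : R) i : (i <= m)%N ->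
    0 < eps <= 1 -> B = 8 / eps -> th = (1 + eps / 2) * D ->
    (\sum_(0 <= j < m | act j) 1) <= D -> disc_le A delta ->
  (\sum_(c | B < x i c) 1) * (eps / 4 * D) <= delta.
Proof.
move=> im /andP[e0 e1] BE thE actD dA.
have D0 : 0 < D by have := th_gt0; rewrite thE; nra.
pose C := fun c => B < x i c.
have hC c : C c -> (1 + eps / 4) * D <= \sum_(0 <= j < i | act j) A j c.
  move=> xc; have x0' : 0 < x i c := lt_trans B_gt0 xc.
  have := inv_x_ge im x0'; rewrite -mulr_suml.
  set s := \sum_(_ <= _ < _ | _) _ => h.
  have : (x i c)^-1 <= eps / 8.
    by rewrite invf_ple ?posrE ?divr_gt0// invf_div -BE ltW.
  have -> : s = s / th * th by rewrite divfK// lt0r_neq0.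
  move: (s / th) h => u h h2.
  have u_ge : 1 - eps / 8 <= u by lra.
  apply: le_trans (ler_wpM2r (ltW th_gt0) u_ge).
  have : 0 <= D * (eps * (2 - eps)) by rewrite !mulr_ge0 ?ltW//; lra.
  by rewrite thE; lra.
have := dA (fun j => (j < i)%N) (fun _ => C) (fun _ _ _ _ _ _ => id).
rewrite ler_norml => /andP[_]; apply: le_trans.
have -> : \sum_(0 <= j < m | act j && (j < i)%N) \sum_(c | C c) (A j c - 1) =
    \sum_(c | C c) \sum_(0 <= j < i | act j) A j c -
    (\sum_(0 <= j < i | act j) 1) * \sum_(c | C c) 1.
  rewrite -(big_nat_widen _ _ _ act _ im) exchange_big/= mulr_sumr -sumrB.
  by apply: eq_bigr => c _; rewrite sumrB mulr1.
have h1 : \sum_(0 <= j < i | act j) (1 : R) <= D.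
  apply: le_trans actD; rewrite (big_nat_widen _ _ _ _ _ im) big_mkcondr/=.
  by apply: ler_sum => j _; case: ifP; rewrite ?ler01.
have h2 : (\sum_(c | C c) 1) * ((1 + eps / 4) * D) <=
    \sum_(c | C c) \sum_(0 <= j < i | act j) A j c.
  by rewrite mulr_suml; apply: ler_sum => c /hC; rewrite mul1r.
have : 0 <= \sum_(c | C c) (1 : R) by apply: sumr_ge0.
nra.
Qed.

(* [Y i c] is the inverse of [x i c] (see [x_liveE]), and [r i] what it would be
   if all the [a j c] were equal to [1]. *)
Let Y i c := 1 - \sum_(0 <= j < i | sc j) (W j)^-1 * a j c.
Let r i := 1 - \sum_(0 <= j < i | sc j) (W j)^-1.
Let mm i : R := \sum_(0 <= j < i | sc j) 1.
Let free i c := 0 < x i c.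
(** The live colors are the free ones still offered. A free color above [B] is frozen: its [q] is
    [0], so its weight stays constant and it is never drawn. *)
Let live i c := free i c && (x i c <= B).
Let g i := N%:R - mm i.

(** A step divides [x] by [1 - q] and subtracts [a / W] from [Y]. On a live color the cap is the
    identity, so [a / W = q / x] and the product is unchanged. Positive weights only grow, so a live
    color was live at all earlier times. *)
Lemma x_liveE i c : (i <= m)%N -> live i c -> x i c * Y i c = 1.
Proof.
elim: i => [_ _|i IH im /andP[xi1 xB]].
  by rewrite x0 /Y big_geq// subr0 mulr1.
have /andP[xi xix] := x_step im xi1.
have li : live i c by rewrite /live /free xi (le_trans xix).
have IHi := IH (ltnW im) li.
have := erefl (Y i.+1 c); rewrite {2}/Y sum_nat_recr opprD addrA -/(Y i c).
case: (boolP (sc i)) => si => [|->]; last by rewrite subr0 x_idle.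
move=> ->; move: xi1; rewrite /free (x_succ im si).
case: ifP => [_|_ _]; first by rewrite ltxx.
have /andP[q0 q1] := q_bound im si (ltW xi).
have qE : q i c = x i c * ((W i)^-1 * a i c).
  by rewrite /q /cap; case/andP: li => _ ->; ring.
have : (1 - q i c) != 0 by apply: lt0r_neq0; lra.
rewrite mulrAC mulrBr IHi -qE => h; by rewrite divff.
Qed.

(** Each successful step kills exactly one free color, [k i]; the other weights are divided by
    [1 - q >= 1/2] and keep their sign. *)
Lemma card_free i : (i <= m)%N -> \sum_(c | free i c) 1 = g i.
Proof.
rewrite /g /mm; elim: i => [_|i IH im].
  rewrite big_geq// subr0 (eq_bigl xpredT) => [|c]; last by rewrite /free x0 ltr01.
  by rewrite sumr_const card_ord.
rewrite sum_nat_recr; case: (boolP (sc i)) => si; last first.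
  rewrite addr0 -IH; last exact: ltnW.
  by apply: eq_bigl => c; rewrite /free x_idle.
rewrite opprD addrA -IH; last exact: ltnW.
have kfree : free i (k i).
  have := k_succ im si; have := x_ge0 (k i) (ltnW im); rewrite /free le_eqVlt.
  case/predU1P => [<-|//]; rewrite /cap ltW//.
  by rewrite mul0r ltxx.
rewrite (bigD1 (k i) kfree)/= addrAC subrr add0r.
apply: eq_bigl => c; rewrite /free (x_succ im si).
case: eqP => [->|_]; first by rewrite ltxx andbF.
have xi := x_ge0 c (ltnW im); have /andP[q0 q1] := q_bound im si xi.
by rewrite andbT pmulr_lgt0// invr_gt0; lra.
Qed.

(** [Y - r] is a combination of the [a j c - 1] with coefficients [(W j)^-1] between [0] and
    [th^-1], over a rectangle of steps and colors. *)
Lemma Y_close (delta : R) i (C : pred 'I_N) : (i <= m)%N -> disc_le a delta ->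
  \sum_(c | C c) `|Y i c - r i| <= 2 * (th^-1 * delta).
Proof.
move=> im da; apply: norm_sum_le_split => S.
pose P j := sc j && (j < i)%N.
pose b j := \sum_(c | C c && S c) (a j c - 1).
have -> : \sum_(c | C c && S c) (Y i c - r i) =
    - \sum_(0 <= j < m | P j) (W j)^-1 * b j.
  rewrite -(big_nat_widen _ _ _ sc _ im) (eq_bigr (fun c =>
    - \sum_(0 <= j < i | sc j) (W j)^-1 * (a j c - 1))).
    by rewrite sumrN exchange_big/=; congr (- _); apply: eq_bigr => j _; rewrite mulr_sumr.
  move=> c _; have E (s t : R) : 1 - s - (1 - t) = t - s by ring.
  by rewrite /Y /r E -sumrB -sumrN; apply: eq_bigr => j _; ring.
have wP j : P j -> 0 <= (W j)^-1 <= th^-1.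
  move=> /andP[sj ji]; have jm := leq_trans ji im; have Wj := W_succ jm sj.
  have W0 := lt_le_trans th_gt0 Wj.
  by rewrite invr_ge0 ltW//= lef_pV2.
have bS (T : pred nat) : `|\sum_(0 <= j < m | P j && T j) b j| <= delta.
  have := da (fun j => [&& ok j, (j < i)%N & T j]) (fun _ c => C c && S c)
    (fun _ _ _ _ _ _ => id).
  by rewrite (eq_bigl (fun j => P j && T j)) => [//|j]; rewrite /P /sc -!andbA.
have M0 : 0 <= th^-1 by rewrite invr_ge0 ltW.
rewrite normrN ler_norml lerNl -sumrN; apply/andP; split.
  rewrite (eq_bigr (fun j => (W j)^-1 * - b j)) => [|j _]; last by rewrite mulrN.
  apply: weighted_sum_le => // T; rewrite sumrN; apply: le_trans (bS T).
  by rewrite -normrN ler_norm.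
by apply: weighted_sum_le => // T; apply: le_trans (bS T); rewrite ler_norm.
Qed.

(** * Few edges at a vertex escape the weight process *)

Section FailCount.
Variables (D eps z eta : R).
Hypothesis eps_bound : 0 < eps <= 10^-1.
Hypothesis B_eq : B = 8 / eps.
Hypothesis th_eq : th = (1 + eps / 2) * D.
Hypothesis N_ge : (1 + eps) * D <= N%:R.
Hypothesis act_le : \sum_(0 <= j < m | act j) 1 <= D.
Hypothesis frozen_le : forall i, (i <= m)%N -> \sum_(c | B < x i c) 1 <= z * D.
Hypothesis z_le : z <= eps ^+ 4 / 10 ^+ 5.
Hypothesis eta_le : 0 <= eta <= eps ^+ 5 / 10 ^+ 6.
Hypothesis disc_a : disc_le a (eta * D ^+ 2).
Hypothesis W_fail : forall i, (i < m)%N -> act i -> ~~ ok i -> W i < th.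

Let D_gt0 : 0 < D.
Proof. by case/andP: eps_bound => e0 _; have := th_gt0; rewrite th_eq pmulr_rgt0; lra. Qed.

Let mm_le i : (i <= m)%N -> 0 <= mm i <= \sum_(0 <= j < m | act j) 1.
Proof.
move=> im; rewrite /mm sumr_ge0//=.
rewrite (big_nat_widen _ _ _ _ _ im) big_mkcond [leRHS]big_mkcond/=.
by apply: ler_sum => j _; rewrite /sc; case: (act j) => //=; case: ifP; rewrite ?ler01.
Qed.

Let g_ge i : (i <= m)%N -> eps * D <= g i.
Proof. by move=> /mm_le /andP[_]; rewrite /g; have := N_ge; have := act_le; lra. Qed.

Let Y_close' i (C : pred 'I_N) : (i <= m)%N ->
  \sum_(c | C c) `|Y i c - r i| <= 2 * eta * D.
Proof.
move=> im; apply: le_trans (Y_close C im disc_a) _.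
rewrite -mulrA ler_pM2l//; case/andP: eta_le => eta0 _.
have thD : D <= th.
  case/andP: eps_bound => e0 _; have := mulr_gt0 e0 D_gt0; rewrite th_eq; lra.
by rewrite mulrCA ler_wpM2l// ler_pdivrMl// expr2 ler_pM2r.
Qed.

Let live_le i : (i <= m)%N -> g i - z * D <= \sum_(c | live i c) 1.
Proof.
move=> im; rewrite -(card_free im) (bigID (fun c => x i c <= B))/= -/(live i _).
rewrite lerBlDr lerD2l; apply: le_trans (frozen_le im).
rewrite big_mkcond [leRHS]big_mkcond/=; apply: ler_sum => c _.
by rewrite -ltNge; case: (B < x i c); rewrite ?andbF ?andbT//; case: ifP.
Qed.

(** A live color has [Y = 1 / x >= 1 / B = eps / 8]. If [r] were below [eps / 16], the at least
    [eps / 2 * D] live colors would all be far from [r], against [Y_close']. *)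
Let r_ge i : (i <= m)%N -> eps / 16 <= r i.
Proof.
move=> im; have /andP[e0 e1] := eps_bound; rewrite leNgt; apply/negP => rlt.
have hY : \sum_(c | live i c) (eps / 8 - r i) <= 2 * eta * D.
  apply: le_trans (Y_close' (live i) im); apply: ler_sum => c lc.
  apply: le_trans (ler_norm _); rewrite lerD2r.
  have xY := x_liveE im lc; have /andP[xc xB] := lc.
  have : x i c * (eps / 8) <= x i c * Y i c.
    rewrite xY; apply: le_trans (_ : B * (eps / 8) <= 1).
      by rewrite ler_wpM2r//; lra.
    by rewrite B_eq; have -> : 8 / eps * (eps / 8) = 1 by field; lra.
  by rewrite ler_pM2l.
have e3 : eps * eps * eps <= 1000^-1.
  have -> : (1000^-1 : R) = 10^-1 * 10^-1 * 10^-1 by field.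
  have e0' := ltW e0; by rewrite !ler_pM ?mulr_ge0.
have e2 : eps ^+ 4 <= eps * 1000^-1.
  have -> : eps ^+ 4 = eps * (eps * eps * eps) by ring.
  exact: (ler_wpM2l (ltW e0) e3).
have e5 : eps ^+ 5 <= eps ^+ 2 * 1000^-1.
  have -> : eps ^+ 5 = eps ^+ 2 * (eps * eps * eps) by ring.
  exact: (ler_wpM2l (sqr_ge0 eps) e3).
have h1 : eps / 2 * D <= \sum_(c | live i c) 1.
  apply: le_trans (live_le im); have := g_ge im; have := z_le => zz gi.
  have : z * D <= eps / 2 * D by rewrite ler_pM2r//; lra.
  lra.
have := hY; rewrite -[X in \sum_(c | _) X]mul1r -mulr_suml.
have /andP[_ eta1] := eta_le.
have h2 : eps / 2 * D * (eps / 16) <= (\sum_(c | live i c) 1) * (eps / 8 - r i).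
  by apply: ler_pM => //; [by rewrite !mulr_ge0// ltW|lra|lra].
have : 0 < eps ^+ 2 * D by rewrite mulr_gt0// exprn_gt0.
have : eta * D <= eps ^+ 2 * 1000^-1 / 10 ^+ 6 * D by rewrite ler_pM2r//; lra.
move: h2; nra.
Qed.

(** On live colors [a = (x * a) * Y], so [r * W] minus the sum of these [a] is a sum of
    [x * a * (r - Y)] with [x * a <= B^2]. Each frozen color costs at most [B] more. *)
Let rW_close i : (i < m)%N -> act i ->
  `|r i * W i - \sum_(c | free i c) a i c| <= eps ^+ 3 / 200 * D.
Proof.
move=> im ai; have im' := ltnW im; have /andP[e0 e1] := eps_bound.
have WE : W i = \sum_(c | live i c) x i c * a i c.
  rewrite /W [RHS]big_mkcond; apply: eq_bigr => c _; rewrite /live /free /cap.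
  have := x_ge0 c im'; rewrite le_eqVlt => /predU1P[<-|->/=]; last by case: ifP; rewrite ?mul0r.
  by rewrite ltxx ltW//= mul0r.
rewrite (bigID (fun c => x i c <= B))/= -/(live i _) opprD addrA.
rewrite WE mulr_sumr -sumrB.
apply: le_trans (ler_normB _ _) _.
have h1 : `|\sum_(c | live i c) (r i * (x i c * a i c) - a i c)| <= B ^+ 2 * (2 * eta * D).
  apply: le_trans (ler_norm_sum _ _ _) _.
  apply: le_trans (ler_wpM2l (sqr_ge0 B) (Y_close' (live i) im')).
  rewrite mulr_sumr; apply: ler_sum => c lc.
  have -> : r i * (x i c * a i c) - a i c = (x i c * a i c) * (r i - Y i c).
    by rewrite mulrBr [x i c * a i c * Y i c]mulrAC (x_liveE im' lc); ring.
  rewrite normrM distrC ler_wpM2r//; case/andP: lc => xc xB.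
  have xa0 : 0 <= x i c * a i c by rewrite mulr_ge0// ltW.
  by rewrite (ger0_norm xa0) expr2; apply: ler_pM => //; [exact: ltW|exact: cap_leB].
have h2 : `|\sum_(c | free i c && ~~ (x i c <= B)) a i c| <= B * (z * D).
  rewrite ger0_norm ?sumr_ge0//; apply: le_trans (ler_wpM2l (ltW B_gt0) (frozen_le im')).
  rewrite mulr_sumr big_mkcond [leRHS]big_mkcond/=; apply: ler_sum => c _.
  rewrite -ltNge; case: (B < x i c); rewrite ?andbF//= andbT mulr1.
  by case: ifP => _; rewrite ?cap_leB// ltW.
apply: le_trans (lerD h1 h2) _; have /andP[_ eta1] := eta_le.
have -> : eps ^+ 3 / 200 * D = (64 / eps ^+ 2) * (2 * (eps ^+ 5 / (512 * 100)) * D) +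
    8 / eps * (eps ^+ 4 / (32 * 100) * D) by field; lra.
have -> : B ^+ 2 = 64 / eps ^+ 2 by rewrite B_eq; field; lra.
have E5 : 0 <= eps ^+ 5 by rewrite exprn_ge0// ltW.
have E4 : 0 <= eps ^+ 4 by rewrite exprn_ge0// ltW.
apply: lerD.
  apply: ler_wpM2l; first by rewrite divr_ge0 ?sqr_ge0.
  by rewrite ler_pM2r//; lra.
rewrite B_eq; apply: ler_wpM2l; first by rewrite divr_ge0// ltW.
by rewrite ler_pM2r//; have := z_le; lra.
Qed.

Let bad i := act i && (eps ^+ 3 / 200 * D < `|\sum_(c | free i c) (a i c - 1)|).

(** Free colors form a staircase, so the absolute values of the row discrepancies sum to at most
    [2 eta D^2]; the count follows by Markov's inequality. *)
Let card_bad : \sum_(0 <= i < m | bad i) 1 <= eps ^+ 2 / 1000 * D.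
Proof.
have /andP[e0 e1] := eps_bound; have /andP[eta0 eta1] := eta_le.
have E3 : 0 < eps ^+ 3 by rewrite exprn_gt0.
pose P i := fun c => (i < m)%N && free i c.
have Pst : staircase P.
  move=> c i j ij _ _ /andP[jm xj]; rewrite /P (leq_ltn_trans ij jm)/=.
  exact: x_gt0_anti (ltnW jm) xj.
have PE i : (i < m)%N -> \sum_(c | P i c) (a i c - 1) = \sum_(c | free i c) (a i c - 1).
  by move=> im; rewrite /P im.
have h : \sum_(0 <= i < m | act i) `|\sum_(c | P i c) (a i c - 1)| <= 2 * (eta * D ^+ 2).
  by apply: norm_sum_le_split => S; exact: disc_a.
have : (\sum_(0 <= i < m | bad i) 1) * (eps ^+ 3 / 200 * D) <= 2 * (eta * D ^+ 2).
  apply: le_trans h; rewrite mulr_suml.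
  rewrite big_nat_cond [leRHS]big_nat_cond big_mkcond [leRHS]big_mkcond/=.
  apply: ler_sum => i _; rewrite /bad; case: (boolP (i < m)%N) => im //=.
  case: (act i) => //=; rewrite mul1r PE//; case: ltP => // /ltW //.
have -> : 2 * (eta * D ^+ 2) = (400 * eta / eps ^+ 3 * D) * (eps ^+ 3 / 200 * D).
  by field; lra.
rewrite ler_pM2r; last by rewrite mulr_gt0// divr_gt0.
move=> hh; apply: le_trans hh _; rewrite ler_pM2r//.
rewrite ler_pdivrMr// mulrAC -exprD; lra.
Qed.

(* The quotient [r / g] is preserved by a step at which [W i = g i / r i]. *)
Let psi_step i : (i < m)%N -> sc i -> r i / g i <= 2 / D ->
  r i.+1 / g i.+1 <= r i / g i + (if bad i then 2 / (eps * D ^+ 2) else eps / (100 * D ^+ 2)).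
Proof.
move=> im si psi2; have /andP[ai _] := si; have /andP[e0 e1] := eps_bound.
have im' := ltnW im.
have g1 := g_ge im; have gE : g i = g i.+1 + 1.
  by rewrite /g /mm sum_nat_recr si; ring.
have rE : r i.+1 = r i - (W i)^-1 by rewrite /r sum_nat_recr si; ring.
have Wi := W_succ im si; have W0 := lt_le_trans th_gt0 Wi.
have eD : 0 < eps * D by rewrite mulr_gt0.
have DW : D <= W i by move: Wi; rewrite th_eq; lra.
have g1_gt0 := lt_le_trans eD g1.
have g_gt0 : 0 < g i by rewrite gE addr_gt0.
have key : r i.+1 / g i.+1 - r i / g i = (r i * W i - g i) / (W i * g i * g i.+1).
  rewrite rE gE; field; rewrite !lt0r_neq0// -gE//.
rewrite -lerBlDl key.
have r0 : 0 < r i by apply: lt_le_trans (r_ge im'); rewrite divr_gt0.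
(* At a bad step the numerator [r W - g] is only bounded by [r W]; at any other step [rW_close]
   bounds it by [eps^3 / 100 * D]. *)
case: ifPn => bi.
  apply: (@le_trans _ _ (r i / g i / g i.+1)).
    rewrite ler_pdivrMr ?mulr_gt0//.
    have -> : r i / g i / g i.+1 * (W i * g i * g i.+1) = r i * W i.
      by field; rewrite !lt0r_neq0.
    lra.
  have -> : 2 / (eps * D ^+ 2) = 2 / D / (eps * D) by field; rewrite !lt0r_neq0.
  apply: ler_pM => //; first by rewrite divr_ge0 ?ltW.
    by rewrite invr_ge0 ltW.
  by rewrite lef_pV2 ?posrE.
have hb : `|\sum_(c | free i c) (a i c - 1)| <= eps ^+ 3 / 200 * D.
  by move: bi; rewrite /bad ai/= -leNgt.
have := rW_close im ai; rewrite sumrB (card_free im') in hb *.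
move: hb; rewrite !ler_norml => /andP[hb1 hb2] /andP[hc1 hc2].
have num : r i * W i - g i <= eps ^+ 3 / 100 * D by lra.
have gg : eps * D <= g i by rewrite gE; lra.
rewrite ler_pdivrMr ?mulr_gt0//; apply: le_trans num _.
have -> : eps ^+ 3 / 100 * D = eps / (100 * D ^+ 2) * (D * (eps * D) * (eps * D)).
  by field; exact: lt0r_neq0.
apply: ler_wpM2l; first by rewrite divr_ge0 ?mulr_ge0 ?sqr_ge0// ltW.
have eD' := ltW eD; have D' := ltW D_gt0.
by apply: ler_pM => //; [rewrite mulr_ge0|apply: ler_pM].
Qed.

(** The quotient starts at [1 / N]. Over at most [D] steps, of which at most [eps^2 / 1000 * D] are
    bad, it grows by at most [(eps / 100 + eps / 500) / D]. The second bound is carried along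
    because it supplies the hypothesis [r / g <= 2 / D] of the next step. *)
Let psi_le i : (i <= m)%N ->
  r i / g i <= ((1 + eps) * D)^-1 + mm i * (eps / (100 * D ^+ 2)) +
    (\sum_(0 <= j < i | bad j) 1) * (2 / (eps * D ^+ 2)) /\
  r i / g i <= ((1 + 3 / 4 * eps) * D)^-1.
Proof.
have /andP[e0 e1] := eps_bound.
have main j : (j <= m)%N ->
    r j / g j <= ((1 + eps) * D)^-1 + mm j * (eps / (100 * D ^+ 2)) +
      (\sum_(0 <= j < j | bad j) 1) * (2 / (eps * D ^+ 2)) ->
    r j / g j <= ((1 + 3 / 4 * eps) * D)^-1.
  move=> jm h; apply: le_trans h _.
  have hm : mm j <= D by have /andP[_ ?] := mm_le jm; exact: le_trans act_le.
  have hb : \sum_(0 <= i < j | bad i) 1 <= eps ^+ 2 / 1000 * D.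
    apply: le_trans card_bad; rewrite (big_nat_widen _ _ _ _ _ jm).
    rewrite big_mkcond [leRHS]big_mkcond/=; apply: ler_sum => c _.
    by case: (bad c) => //=; case: ifP; rewrite ?ler01.
  have h1 : mm j * (eps / (100 * D ^+ 2)) <= eps / 100 / D.
    have -> : eps / 100 / D = D * (eps / (100 * D ^+ 2)) by field; exact: lt0r_neq0.
    by apply: ler_wpM2r => //; rewrite divr_ge0 ?mulr_ge0 ?sqr_ge0// ltW.
  have h2 : (\sum_(0 <= j < j | bad j) 1) * (2 / (eps * D ^+ 2)) <= eps / 500 / D.
    have -> : eps / 500 / D = (eps ^+ 2 / 1000 * D) * (2 / (eps * D ^+ 2)).
      by field; rewrite !lt0r_neq0.
    by apply: ler_wpM2r => //; rewrite divr_ge0// mulr_ge0 ?sqr_ge0// ltW.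
  apply: le_trans (lerD (lerD (lexx _) h1) h2) _.
  have -> : ((1 + eps) * D)^-1 + eps / 100 / D + eps / 500 / D =
    ((1 + eps)^-1 + eps * (12 / 1000)) / D by field; rewrite !lt0r_neq0//; lra.
  rewrite invfM ler_pM2r ?invr_gt0//.
  rewrite -[leRHS]mul1r ler_pdivlMr; last by lra.
  set t := (1 + eps)^-1.
  have t1 : t * (1 + eps) = 1 by rewrite mulVf//; lra.
  have t0 : 10 / 11 <= t by have : 0 < t by [rewrite invr_gt0; lra]; nra.
  nra.
elim: i => [m0|i IH im].
  suff h : r 0 / g 0 <= ((1 + eps) * D)^-1 + mm 0 * (eps / (100 * D ^+ 2)) +
    (\sum_(0 <= j < 0 | bad j) 1) * (2 / (eps * D ^+ 2)) by split => //; exact: main.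
  rewrite /r /g /mm !big_geq// !subr0 !mul0r !addr0 mul1r lef_pV2 ?posrE//.
    by rewrite (lt_le_trans _ N_ge)// mulr_gt0//; lra.
  by rewrite mulr_gt0//; lra.
have [IH1 IH2] := IH (ltnW im).
have IH3 : r i / g i <= 2 / D.
  apply: le_trans IH2 _; rewrite invfM ler_pM2r ?invr_gt0//.
  by rewrite (@le_trans _ _ 1)// ?invf_le1//; lra.
suff h : r i.+1 / g i.+1 <= ((1 + eps) * D)^-1 + mm i.+1 * (eps / (100 * D ^+ 2)) +
    (\sum_(0 <= j < i.+1 | bad j) 1) * (2 / (eps * D ^+ 2)) by split => //; exact: main.
have u0 : 0 <= eps / (100 * D ^+ 2) by rewrite divr_ge0 ?mulr_ge0 ?sqr_ge0// ltW.
have v0 : 0 <= 2 / (eps * D ^+ 2) by rewrite divr_ge0 ?mulr_ge0 ?sqr_ge0// ltW.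
rewrite sum_nat_recr /mm sum_nat_recr -/(mm i).
case: (boolP (sc i)) => si.
  apply: le_trans (psi_step im si IH3) _.
  by case: (bad i) => /=; move: IH1 u0 v0; set u := eps / _; set v := 2 / _; lra.
have -> : r i.+1 / g i.+1 = r i / g i.
  by rewrite /r /g /mm !sum_nat_recr (negbTE si) !addr0.
apply: le_trans IH1 _.
by case: (bad i) => /=; move: u0 v0; set u := eps / _; set v := 2 / _; lra.
Qed.

(** A failed step must be bad: otherwise [W] is within [eps^3 / 100 * D / r] of
    [g / r >= (1 + 3/4 eps) D], and [r >= eps / 16] makes this error too small for [W < th]. *)
Lemma card_fail : \sum_(0 <= i < m | act i && ~~ ok i) 1 <= eps ^+ 2 / 1000 * D.
Proof.
apply: le_trans card_bad; have /andP[e0 e1] := eps_bound.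
rewrite big_nat_cond [leRHS]big_nat_cond big_mkcond [leRHS]big_mkcond/=.
apply: ler_sum => i _; case: (boolP (i < m)%N) => im //=.
rewrite /bad; case: (boolP (act i)) => ai //=.
case: (boolP (ok i)) => oi/=; first by case: ifP; rewrite ?ler01.
case: ltP => // hb; exfalso.
have im' := ltnW im; have Wlt := W_fail im ai oi.
have [_ psi] := psi_le im'.
have r0 := r_ge im'; have r_gt0 : 0 < r i by apply: lt_le_trans r0; rewrite divr_gt0.
have g_gt0 : 0 < g i by apply: lt_le_trans (g_ge im'); rewrite mulr_gt0.
move: psi; rewrite ler_pdivrMr// mulrC ler_pdivlMr; last by rewrite mulr_gt0//; lra.
move=> psi.
have := rW_close im ai; rewrite sumrB (card_free im') in hb *.
move: hb; rewrite !ler_norml => /andP[hb1 hb2] /andP[hc1 hc2].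
have : r i * W i <= r i * ((1 + eps / 2) * D) by rewrite -th_eq ler_pM2l// ltW.
have e3 : eps ^+ 3 <= eps * (eps * 10^-1).
  by rewrite !exprS expr0 mulr1 !ler_wpM2l// ltW.
have h4 : eps ^+ 3 * D <= eps * (eps * 10^-1) * D by rewrite ler_pM2r.
have h5 : eps / 16 * (eps * D) <= r i * (eps * D) by rewrite ler_pM2r// mulr_gt0.
have : 0 < eps * eps * D by rewrite !mulr_gt0.
by move: psi h4 h5 hc1 hb1; lra.
Qed.

End FailCount.

End VertexDynamics.

(** * Adaptive random choices *)

Section AdaptiveLaw.
Variables (R : realType) (E C : finType) (law : seq (E * C) -> E -> C -> R) (K : nat).
Hypothesis law_ge0 : forall z e c, 0 <= law z e c.
Hypothesis law_sum1 : forall z e, \sum_c law z e c = 1.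

(* A seed fixes in advance, independently over all possible transcripts of
   length at most [K] and all next edges, the choice that would be made there. *)
Definition context : finType := ({bseq K of (E * C)%type} * E)%type.
Definition tape : finType := {ffun context -> C}.

(** A transcript longer than [K] is read as a default one, so statements on [choice] assume
    transcripts of length at most [K]. *)
Definition choice (f : tape) (z : seq (E * C)) (e : E) : C := f (insub_bseq K z, e).

Definition play (f : tape) (h : seq E) : seq (E * C) :=
  foldl (fun z e => rcons z (e, choice f z e)) [::] h.

Definition weight (f : tape) : R :=
  \prod_(i : context) law (val i.1) i.2 (f i).

Definition redraw (f : tape) (i : context) (c : C) : tape :=
  [ffun j => if j == i then c else f j].

Lemma play_rcons f h e :
  play f (rcons h e) = rcons (play f h) (e, choice f (play f h) e).
Proof. by rewrite /play foldl_rcons. Qed.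

Lemma unzip1_play f h : unzip1 (play f h) = h.
Proof.
elim/last_ind: h => // h e IH; by rewrite play_rcons /unzip1 map_rcons -/(unzip1 _) IH.
Qed.

Lemma size_play f h : size (play f h) = size h.
Proof. by rewrite -[in RHS](unzip1_play f h) size_map. Qed.

Lemma take_play f h i : take i (play f h) = play f (take i h).
Proof.
elim/last_ind: h => // h e IH; rewrite play_rcons -!cats1 !take_cat size_play.
case: ltnP => // ih; case: (i - size h)%N => [|j]; first by rewrite !cats0.
by rewrite /= !cats1 play_rcons.
Qed.

Lemma weight_ge0 f : 0 <= weight f.
Proof. exact: prodr_ge0. Qed.

Lemma weight_sum1 : \sum_f weight f = 1.
Proof.
rewrite /weight -(bigA_distr_bigA (fun i : context => law (val i.1) i.2)).
by apply: big1 => i _; exact: law_sum1.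
Qed.

(** This excludes, on every tape that matters, a draw of probability zero, and so lets probabilistic
    rules be used deterministically. *)
Lemma weight_gt0_law f z e : 0 < weight f -> (size z <= K)%N ->
  0 < law z e (choice f z e).
Proof.
rewrite /weight (bigD1 (insub_bseq K z, e))//= => w0 zK.
have := w0; rewrite /insub_bseq /insubd insubT/= => w1.
rewrite lt_neqAle law_ge0 andbT eq_sym; apply: contraTneq w1.
rewrite /choice /insub_bseq /insubd insubT/= => ->; by rewrite mul0r ltxx.
Qed.

(** Playing [h] consults only transcripts strictly shorter than [h], hence never the redrawn
    context. *)
Lemma play_redraw f z e c h : (size h <= size z)%N -> (size z <= K)%N ->
  play (redraw f (insub_bseq K z, e) c) h = play f h.
Proof.
move=> hz zK; elim/last_ind: h hz => // h e' IH; rewrite size_rcons => hz.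
rewrite !play_rcons IH ?(ltnW hz)//; congr (rcons _ (_, _)).
rewrite /choice ffunE xpair_eqE; case: eqP => //= /(congr1 (fun b => size (val b))).
have hK : (size (play f h) <= K)%N by rewrite size_play (leq_trans (ltnW hz)).
rewrite /insub_bseq /insubd !insubT/= size_play => hE.
by rewrite hE ltnn in hz.
Qed.

Lemma weight_redraw f i c :
  weight f * law (val i.1) i.2 c =
  weight (redraw f i c) * law (val i.1) i.2 (f i).
Proof.
rewrite /weight (bigD1 i)//= [in RHS](bigD1 i)//= ffunE eqxx.
rewrite [in RHS](eq_bigr (fun j : context => law (val j.1) j.2 (f j))); first by ring.
by move=> j /negbTE ji; rewrite ffunE ji.
Qed.

(** Resampling one entry preserves the law, even if its position depends on the tape, as long as it
    does not depend on the entry itself. Exchanging the entry with the fresh draw is an involution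
    that preserves the joint weight. *)
Lemma expect_redraw (i : tape -> context) (G : tape -> R) :
    (forall f c, i (redraw f (i f) c) = i f) ->
  \sum_f weight f * G f =
  \sum_f weight f * \sum_c law (val (i f).1) (i f).2 c * G (redraw f (i f) c).
Proof.
move=> iE; pose h (p : tape * C) := (redraw p.1 (i p.1) p.2, p.1 (i p.1)).
have hK : involutive h.
  case=> f c; rewrite /h/= iE ffunE eqxx; congr (_, _).
  apply/ffunP => j; rewrite !ffunE; by case: eqP => [->|].
pose F (p : tape * C) := weight p.1 * law (val (i p.1).1) (i p.1).2 p.2 * G p.1.
transitivity (\sum_p F p).
  rewrite -(pair_bigA _ (fun f c => F (f, c)))/=; apply: eq_bigr => f _.
  by rewrite /F/= -mulr_suml -mulr_sumr law_sum1 mulr1.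
rewrite (reindex_inj (inv_inj hK))/= -(pair_bigA _ (fun f c => F (h (f, c))))/=.
apply: eq_bigr => f _; rewrite mulr_sumr; apply: eq_bigr => c _.
by rewrite /F /h/= iE -weight_redraw mulrA.
Qed.

(** The context of the last draw is determined by the earlier draws, so redrawing it turns the sum
    over tapes into one of conditional expectations. Length [K.+1] is allowed because only the
    transcript before each edge is looked up. *)
Lemma expect_supermartingale (s : seq E) (Phi : seq (E * C) -> R) :
    (size s <= K.+1)%N ->
    (forall h e s' z, s = rcons h e ++ s' -> unzip1 z = h ->
       \sum_c law z e c * Phi (rcons z (e, c)) <= Phi z) ->
  \sum_f weight f * Phi (play f s) <= Phi [::].
Proof.
elim/last_ind: s => [_ _|s e IH]; first by rewrite /play/= -mulr_suml weight_sum1 mul1r.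
rewrite size_rcons ltnS => sK hPhi.
have sub : \sum_f weight f * Phi (play f s) <= Phi [::].
  apply: IH => [|h e' s' z sE]; first exact: ltnW.
  by apply: (hPhi h e' (rcons s' e)); rewrite -rcons_cat -sE.
apply: le_trans sub; pose i f : context := (insub_bseq K (play f s), e).
have iE f c : i (redraw f (i f) c) = i f.
  by rewrite /i play_redraw ?size_play.
rewrite (expect_redraw (fun f => Phi (play f (rcons s e))) iE).
apply: ler_sum => f _; apply: ler_wpM2l; first exact: weight_ge0.
rewrite (eq_bigr (fun c => law (play f s) e c * Phi (rcons (play f s) (e, c)))).
  by apply: (hPhi s e [::]); rewrite ?cats0 ?unzip1_play.
move=> c _; rewrite play_rcons /i play_redraw ?size_play//.
rewrite /choice ffunE eqxx/=; congr (law _ _ _ * _).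
by rewrite /insub_bseq /insubd insubT ?size_play.
Qed.

End AdaptiveLaw.

(** * A finite law carried by the natural numbers *)

Section FiniteLaw.
Local Open Scope classical_set_scope.
Variables (R : realType) (T : finType) (t0 : T) (w : T -> R).
Hypothesis w_ge0 : forall t, 0 <= w t.
Hypothesis w_sum1 : \sum_t w t = 1.

(** Seeds are natural numbers, on which every function is measurable. The law charges only codes of
    elements, so the default [t0] has no effect on probabilities. *)
Definition decode (k : nat) : T := odflt t0 (unpickle k).

Let atom (j : nat) : {measure set nat -> \bar R} :=
  mscale (NngNum (w_ge0 (nth t0 (enum T) j))) \d_(pickle (nth t0 (enum T) j)).

Definition finite_law : set nat -> \bar R := msum atom #|T|.

HB.instance Definition _ := Measure.on finite_law.

Lemma finite_lawE (Q : pred T) :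
  finite_law [set k | Q (decode k)] = (\sum_(t | Q t) w t)%:E.
Proof.
rewrite /finite_law /msum /=.
rewrite (eq_bigr (fun i : 'I_#|T| => (if Q (enum_val i) then w (enum_val i) else 0)%:E)).
  by rewrite sumEFin -(big_enum_val (fun t => if Q t then w t else 0)) -big_mkcond.
move=> i _; rewrite /mscale/= diracE -(enum_val_nth t0 i).
rewrite mem_setE /decode unfold_in/= pickleK/=.
by case: (Q _); rewrite /= ?mule1 ?mule0.
Qed.

Lemma finite_law_setT : finite_law setT = 1%E.
Proof.
have -> : setT = [set k | predT (decode k)] by apply/seteqP; split.
by rewrite finite_lawE w_sum1.
Qed.

HB.instance Definition _ := Measure_isProbability.Build _ _ _ finite_law finite_law_setT.

Definition finite_probability : probability nat R := finite_law.

End FiniteLaw.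

(** * The weight process *)

Section State.
Variables (R : realType) (n N' : nat) (B th : R).
Local Notation N := N'.+1.

Definition state : Type := 'I_n -> 'I_N -> R.

Implicit Types (x : state) (e : {set 'I_n}) (c : 'I_N).

Definition wt x e c : R := \prod_(v in e) cap B (x v c).

Definition total_wt x e : R := \sum_c wt x e c.

Definition prob x e c : R := wt x e c / total_wt x e.

(** The size is tested because an online algorithm must answer on arbitrary vertex sets, not only on
    edges. *)
Definition admits x e : bool := (#|e| == 2)%N && (th <= total_wt x e).

Definition colors x e c : bool := admits x e && (0 < wt x e c).

Definition step x (p : {set 'I_n} * 'I_N) : state := fun v c =>
  if colors x p.1 p.2 && (v \in p.1) then
    if c == p.2 then 0 else x v c / (1 - prob x p.1 c)
  else x v c.

Definition state_after (z : seq ({set 'I_n} * 'I_N)) : state :=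
  foldl step (fun _ _ => 1) z.

Definition color_law x e c : R :=
  if admits x e then prob x e c else (c == ord0)%:R.

Definition bounded_state x : Prop := forall v c, 0 <= x v c <= 2 * B.

Hypothesis B_ge1 : 1 <= B.
Hypothesis B_th : 2 * B ^+ 2 <= th.

Let B_gt0 : 0 < B. Proof. exact: lt_le_trans B_ge1. Qed.
Let th_gt0 : 0 < th.
Proof. by apply: lt_le_trans B_th; rewrite mulr_gt0// exprn_gt0. Qed.

Lemma wt_ge0 x e c : bounded_state x -> 0 <= wt x e c.
Proof. by move=> xb; apply: prodr_ge0 => v _; apply: cap_ge0; have /andP[] := xb v c. Qed.

Lemma total_gt0 x e : admits x e -> 0 < total_wt x e.
Proof. by case/andP => _; exact: lt_le_trans. Qed.

Lemma prob_bound x e c : bounded_state x -> admits x e -> 0 <= prob x e c <= 2^-1.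
Proof.
move=> xb ae; have t0 := total_gt0 ae; have /andP[/eqP e2 tth] := ae.
rewrite /prob divr_ge0 ?wt_ge0 ?(ltW t0)//= ler_pdivrMr//.
have : wt x e c <= B ^+ 2.
  rewrite -e2 -prodr_const; apply: ler_prod => v _; rewrite cap_leB// andbT.
  by apply: cap_ge0; have /andP[] := xb v c.
by have := B_th; lra.
Qed.

Lemma prob_sum1 x e : admits x e -> \sum_c prob x e c = 1.
Proof. by move=> ae; rewrite /prob -mulr_suml divff// lt0r_neq0// total_gt0. Qed.

(** A weight at most [B] is at most doubled since [prob <= 1/2]; a weight above [B] has [prob = 0]
    and no longer grows. *)
Lemma bounded_step x p : bounded_state x -> bounded_state (step x p).
Proof.
move=> xb v c; rewrite /step; case: ifP => [/andP[/andP[ae _] ve]|_]; last exact: xb.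
have /andP[x0 x2] := xb v c.
case: eqP => _; first by rewrite lexx mulr_ge0// ltW.
have /andP[p0 p1] := prob_bound c xb ae; have q0 : 0 < 1 - prob x p.1 c by lra.
rewrite divr_ge0 ?(ltW q0)//= ler_pdivrMr//.
case: (leP (x v c) B) => xB; first by nra.
suff -> : prob x p.1 c = 0 by rewrite subr0 mulr1.
by rewrite /prob /wt (bigD1 v)//= /cap leNgt xB/= !mul0r.
Qed.

Lemma bounded_state_after z : bounded_state (state_after z).
Proof.
rewrite /state_after; have : bounded_state (fun _ _ => 1).
  by move=> v c; rewrite ler01/=; have := B_ge1; lra.
by elim: z (fun _ _ => 1) => //= p z IH x xb; apply: IH; exact: bounded_step.
Qed.

Lemma state_after_rcons z p : state_after (rcons z p) = step (state_after z) p.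
Proof. by rewrite /state_after foldl_rcons. Qed.

Lemma color_law_ge0 x e c : bounded_state x -> 0 <= color_law x e c.
Proof.
move=> xb; rewrite /color_law; case: ifP => [ae|_]; last exact: ler0n.
by have /andP[] := prob_bound c xb ae.
Qed.

Lemma color_law_sum1 x e : \sum_c color_law x e c = 1.
Proof.
rewrite /color_law; case: (boolP (admits x e)) => ae; first exact: prob_sum1.
by rewrite (bigD1 ord0)//= big1 ?addr0// => c /negbTE ->.
Qed.

Lemma color_law_gt0 x e c : 0 < color_law x e c -> admits x e -> colors x e c.
Proof.
rewrite /color_law /colors => + ae; rewrite ae/= /prob => h.
by move: h; rewrite pmulr_lgt0// invr_gt0 total_gt0.
Qed.

Lemma sqr_sum_card2 (I : finType) (S : {set I}) (y : I -> R) : (#|S| <= 2)%N ->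
  (\sum_(i in S) y i) ^+ 2 <= 2 * \sum_(i in S) y i ^+ 2.
Proof.
case E: #|S| => [|[|[|//]]] _.
- by move/eqP: E; rewrite cards_eq0 => /eqP ->; rewrite !big_set0 expr0n mulr0.
- move/eqP/cards1P: E => [i ->]; rewrite !big_set1; have := sqr_ge0 (y i); lra.
- move/eqP/cards2P: E => [i [j [ij ->]]].
  rewrite !big_setU1 ?inE//= !big_set1.
  by have := sqr_ge0 (y i - y j); rewrite sqrrB sqrrD; lra.
Qed.

(** The exponential corrected as in [expR_scaling_step]. Its value [1] at [0] makes the factor of a
    weight that has dropped to [0] disappear. *)
Definition tilt (lam t : R) : R := expR (lam * t - 16 * (lam * t) ^+ 2).

Lemma tilt0 lam : tilt lam 0 = 1.
Proof. by rewrite /tilt !(mulr0, expr0n, subr0) expR0. Qed.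

Section OneStep.
Variables (I : finType) (o : I -> 'I_n) (H : I -> pred 'I_N) (lam : R).
Hypothesis o_inj : forall i j c d, H i c -> H j d -> o i = o j -> i = j.
Hypothesis lam_small : `|lam| * (64 * B) <= 1.

Let Z x c : R := \sum_(i | H i c) lam * x (o i) c.

Let fac x e c : R := \prod_(i | H i c && (o i \in e)) tilt lam (x (o i) c).

Let rest x e : R := \prod_c \prod_(i | H i c && (o i \notin e)) tilt lam (x (o i) c).

Let fac_split x e :
  \prod_c \prod_(i | H i c) tilt lam (x (o i) c) = rest x e * \prod_c fac x e c.
Proof.
rewrite /rest -big_split/=; apply: eq_bigr => c _.
by rewrite (bigID (fun i => o i \in e))/= mulrC.
Qed.

(** Only weights at the two ends of [e] change, so [rest] factors out. The drawn color then
    contributes [1] and any other color [U d], as in [sum_prod_exclusive]; the bound per color is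
    [expR_scaling_step], applied to the sum of the at most two exponents involved. *)
Lemma expected_tilt_step x e : bounded_state x ->
  \sum_c color_law x e c *
      \prod_d \prod_(i | H i d) tilt lam (step x (e, c) (o i) d)
    <= \prod_d \prod_(i | H i d) tilt lam (x (o i) d).
Proof.
move=> xb; case: (boolP (admits x e)) => ae; last first.
  rewrite (eq_bigr (fun c => color_law x e c *
      \prod_d \prod_(i | H i d) tilt lam (x (o i) d))).
    by rewrite -mulr_suml color_law_sum1 mul1r.
  by move=> c _; rewrite /step /colors (negbTE ae).
have card_e : #|e| = 2%N by case/andP: ae => /eqP.
pose U d := \prod_(i | H i d && (o i \in e)) tilt lam (x (o i) d / (1 - prob x e d)).
rewrite (eq_bigr (fun c => rest x e * (prob x e c * \prod_(d | d != c) U d))); last first.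
  move=> c _; rewrite /color_law ae; have [->|p0] := eqVneq (prob x e c) 0.
    by rewrite !mul0r mulr0.
  have cc : colors x e c.
    apply: color_law_gt0 => //; rewrite lt_neqAle color_law_ge0// andbT eq_sym.
    by rewrite /color_law ae.
  rewrite mulrCA; congr (_ * _).
  rewrite (fac_split _ e); congr (_ * _).
    apply: eq_bigr => d _; apply: eq_bigr => i /andP[_ /negbTE oe].
    by rewrite /step/= oe andbF.
  rewrite (bigD1 c)//= [X in X * _]big1 ?mul1r.
    apply: eq_bigr => d /negbTE dc; apply: eq_bigr => i /andP[_ oe].
    by rewrite /step/= cc oe dc.
  by move=> i /andP[_ oe]; rewrite /step/= cc oe eqxx tilt0.
rewrite -mulr_sumr (fac_split x e); apply: ler_wpM2l.
  by apply: prodr_ge0 => d _; apply: prodr_ge0 => i _; exact: expR_ge0.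
have UE d : U d = expR (
    (\sum_(i in [set i | H i d && (o i \in e)]) lam * x (o i) d) / (1 - prob x e d) -
    16 * ((\sum_(i in [set i | H i d && (o i \in e)]) (lam * x (o i) d) ^+ 2) /
      (1 - prob x e d) ^+ 2)).
  rewrite /U /tilt -expR_sum !mulr_suml mulr_sumr -sumrB.
  congr expR; apply: eq_big => [i|i _]; first by rewrite inE.
  by rewrite mulrA expr_div_n.
have VE d : fac x e d = expR ((\sum_(i in [set i | H i d && (o i \in e)]) lam * x (o i) d) -
    16 * (\sum_(i in [set i | H i d && (o i \in e)]) (lam * x (o i) d) ^+ 2)).
  rewrite /fac /tilt -expR_sum mulr_sumr -sumrB.
  by congr expR; apply: eq_bigl => i; rewrite inE.
apply: sum_prod_exclusive.
- by move=> c; have /andP[] := prob_bound c xb ae.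
- exact: prob_sum1.
- by move=> d; apply: prodr_gt0 => i _; exact: expR_gt0.
- have y_bound d i : 0 <= x (o i) d / (1 - prob x e d) <= 4 * B.
    have /andP[x0 x2] := xb (o i) d; have /andP[p0 p1] := prob_bound d xb ae.
    have q0 : 0 < 1 - prob x e d by lra.
    rewrite divr_ge0 ?(ltW q0)//= ler_pdivrMr//.
    have : 0 <= B * (2^-1 - prob x e d) by rewrite mulr_ge0 ?(ltW B_gt0)// subr_ge0.
    lra.
  (* All [U d] lie on the same side of [1], given by the sign of [lam]: rescaled weights are at most
     [4 B], hence [16 lam y <= 1] and [lam y - 16 (lam y)^2] has the sign of [lam]. *)
  case: (leP 0 lam) => l0; [right|left] => d.
    rewrite /U; elim/big_ind: _ => // [u v u1 v1|i _]; first by nra.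
    rewrite /tilt -[leLHS]expR0 ler_expR subr_ge0.
    have /andP[] := y_bound d i; set y := x _ _ / _ => y0 y1.
    have ly : 16 * (lam * y) <= 1.
      have := ler_wpM2l l0 y1; have := lam_small; rewrite (ger0_norm l0); lra.
    by rewrite expr2 mulrA -[leRHS]mul1r ler_wpM2r// mulr_ge0.
  suff /andP[] : 0 <= U d <= 1 by [].
  rewrite /U; elim/big_ind: _ => [|u v /andP[? ?] /andP[? ?]|i _].
    by rewrite ler01 lexx.
  by rewrite mulr_ge0// mulr_ile1.
  rewrite /tilt expR_ge0/= expR_le1 subr_le0.
  have /andP[y0 _] := y_bound d i.
  apply: (@le_trans _ _ 0); first by rewrite mulr_le0_ge0// ltW.
  by rewrite mulr_ge0// sqr_ge0.
- move=> d; set S := [set i | H i d && (o i \in e)] in UE VE *.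
  have cS : (#|S| <= 2)%N.
    rewrite -card_e -(card_in_imset (f := o)).
      by apply/subset_leq_card/fintype.subsetP => v /imsetP[i]; rewrite inE => /andP[_ ?] ->.
    by move=> i j; rewrite !inE => /andP[hi _] /andP[hj _]; exact: o_inj hi hj.
  rewrite UE VE; apply: expR_scaling_step; first exact: prob_bound.
    exact: sqr_sum_card2.
  apply: (@le_trans _ _ (\sum_(i in S) 1024^-1)).
    apply: ler_sum => i _; have /andP[x0 x2] := xb (o i) d.
    have h : `|lam * x (o i) d| <= 32^-1.
      rewrite normrM (ger0_norm x0).
      by have := ler_wpM2l (normr_ge0 lam) x2; have := lam_small; lra.
    have -> : (1024^-1 : R) = 32^-1 ^+ 2 by field.
    by rewrite -[leLHS]ger0_norm ?sqr_ge0// normrX lerXn2r ?nnegrE ?invr_ge0.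
  rewrite sumr_const -mulr_natl.
  have : (#|S|%:R : R) <= 2 by rewrite ler_nat.
  lra.
Qed.

End OneStep.

End State.

(** * Concentration *)

Lemma exp_markov (R : realType) (T : finType) (w Phi : T -> R) (P : pred T) (L M : R) :
    (forall t, 0 <= w t) -> (forall t, 0 <= Phi t) ->
    \sum_t w t * Phi t <= M -> (forall t, P t -> expR L <= Phi t) ->
  \sum_(t | P t) w t <= expR (- L) * M.
Proof.
move=> w0 Phi0 EM PL; apply: le_trans (ler_wpM2l (expR_ge0 _) EM).
rewrite mulr_sumr big_mkcond; apply: ler_sum => t _.
case: ifP => [/PL h|_]; last by rewrite !mulr_ge0// expR_ge0.
rewrite mulrCA -[leLHS]mulr1 ler_wpM2l// expRN.
by rewrite mulrC ler_pdivlMr ?mul1r// expR_gt0.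
Qed.

Section Concentration.
Variables (R : realType) (n N' : nat) (B th : R) (K : nat).
Local Notation N := N'.+1.
Local Notation edge := {set 'I_n}.
Hypothesis B_ge1 : 1 <= B.
Hypothesis B_th : 2 * B ^+ 2 <= th.

Definition transcript_law (z : seq (edge * 'I_N)) (e : edge) (c : 'I_N) : R :=
  color_law B th (state_after B th z) e c.

Local Notation st := (state_after B th).
Local Notation tp := (tape edge 'I_N K).
Local Notation w := (weight transcript_law (K := K)).

Lemma transcript_law_ge0 z e c : 0 <= transcript_law z e c.
Proof. by apply: color_law_ge0 => //; exact: bounded_state_after. Qed.

Lemma transcript_law_sum1 z e : \sum_c transcript_law z e c = 1.
Proof. exact: color_law_sum1. Qed.

Section Tail.
Variables (s : seq edge) (I : finType) (time : I -> nat) (o : I -> 'I_n).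
Variable H : I -> pred 'I_N.
Hypothesis s_size : (size s <= K.+1)%N.
Hypothesis o_inj : forall i j c d, H i c -> H j d -> o i = o j -> i = j.

(** The weight at [o i] stopped at [time i]: [take] leaves shorter transcripts unchanged, so this is
    the current weight until then and a constant afterwards. *)
Let X (z : seq (edge * 'I_N)) i c : R := st (take (time i) z) (o i) c.

Let Phi lam z : R := \prod_c \prod_(i | H i c) tilt lam (X z i c).

Let h : R := \sum_c \sum_(i | H i c) 1.

(** Factors whose time has passed are constant and the others evolve by [expected_tilt_step], so
    [Phi] is a supermartingale. All weights start at [1], whence the initial bound. *)
Let Phi_expect lam : `|lam| * (64 * B) <= 1 ->
  \sum_(f : tp) w f * Phi lam (play f s) <= expR (lam * h).
Proof.
move=> lam_small.
have nilE : Phi lam [::] <= expR (lam * h).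
  rewrite /h mulr_sumr expR_sum; apply: ler_prod => c _.
  rewrite mulr_sumr expR_sum prodr_ge0/= => [|i _]; last exact: expR_ge0.
  apply: ler_prod => i _; rewrite /tilt expR_ge0/= ler_expR /X/= mulr1.
  by rewrite gerDl oppr_le0 mulr_ge0// sqr_ge0.
apply: le_trans nilE.
apply: expect_supermartingale => //; first exact: transcript_law_ge0.
  exact: transcript_law_sum1.
move=> pre e s' z _ _; set t := size z.
pose past y := \prod_c \prod_(i | H i c && (time i <= t)%N) tilt lam (X y i c).
pose Hf i : pred 'I_N := fun c => H i c && (t < time i)%N.
have PhiE y : Phi lam y = past y * \prod_c \prod_(i | Hf i c) tilt lam (X y i c).
  rewrite /past -big_split/=; apply: eq_bigr => c _.
  rewrite (bigID (fun i => time i <= t)%N)/=; congr (_ * _).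
  by apply: eq_bigl => i; rewrite /Hf ltnNge.
have pastE c : past (rcons z (e, c)) = past z.
  apply: eq_bigr => d _; apply: eq_bigr => i /andP[_ it].
  by rewrite /X -cats1 takel_cat.
have past0 : 0 <= past z.
  by apply: prodr_ge0 => c _; apply: prodr_ge0 => i _; exact: expR_ge0.
rewrite PhiE (eq_bigr (fun c => past z * (color_law B th (st z) e c *
    \prod_d \prod_(i | Hf i d) tilt lam (step B th (st z) (e, c) (o i) d)))).
  rewrite -mulr_sumr ler_wpM2l//.
  rewrite [leRHS](eq_bigr (fun d => \prod_(i | Hf i d) tilt lam (st z (o i) d))).
    apply: expected_tilt_step => //; last exact: bounded_state_after.
    by move=> i j c d /andP[hi _] /andP[hj _]; exact: o_inj hi hj.
  move=> d _; apply: eq_bigr => i /andP[_ it].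
  by rewrite /X take_oversize// ltnW.
move=> c _; rewrite PhiE pastE mulrCA; congr (_ * (_ * _)).
apply: eq_bigr => d _; apply: eq_bigr => i /andP[_ it].
by rewrite /X take_oversize ?size_rcons// state_after_rcons.
Qed.

(* Bounding the quadratic part of the exponent by a multiple of [x], and not by a
   constant, saves a factor [B] in the tail bound. *)
Let Phi_ge lam f :
  expR ((lam - 32 * lam ^+ 2 * B) * \sum_c \sum_(i | H i c) X f i c) <= Phi lam f.
Proof.
rewrite mulr_sumr expR_sum; apply: ler_prod => c _; rewrite expR_ge0/=.
rewrite mulr_sumr expR_sum; apply: ler_prod => i _; rewrite expR_ge0/=.
rewrite /tilt ler_expR exprMn.
have /andP[x0 x2] := bounded_state_after B_ge1 B_th (take (time i) f) (o i) c.
rewrite /X; set x := st _ _ _ in x0 x2 *.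
have : 0 <= lam ^+ 2 * (x * (2 * B - x)) by rewrite mulr_ge0 ?sqr_ge0// mulr_ge0 ?subr_ge0.
lra.
Qed.

Lemma discrepancy_tail (D eta : R) : 0 < eta <= 1 -> h <= 2 * D ^+ 2 ->
  \sum_(f : tp | eta * D ^+ 2 <
      `|\sum_c \sum_(i | H i c) (st (take (time i) (play f s)) (o i) c - 1)|) w f
    <= 2 * expR (- (eta ^+ 2 * D ^+ 2 / (512 * B))).
Proof.
move=> /andP[eta0 eta1] hD.
have B0 : 0 < B := lt_le_trans ltr01 B_ge1.
pose Y (f : tp) := \sum_c \sum_(i | H i c) X (play f s) i c.
have YE (f : tp) :
    \sum_c \sum_(i | H i c) (st (take (time i) (play f s)) (o i) c - 1) = Y f - h.
  by rewrite /Y /h -sumrB; apply: eq_bigr => c _; rewrite sumrB.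
have Y0 (f : tp) : 0 <= Y f.
  apply: sumr_ge0 => c _; apply: sumr_ge0 => i _.
  by have /andP[] := bounded_state_after B_ge1 B_th (take (time i) (play f s)) (o i) c.
have h0 : 0 <= h by apply: sumr_ge0 => c _; apply: sumr_ge0.
(* For [lam = l] or [- l] the correction [32 l^2 B] is [l * eta / 8]. As [h <= 2 D^2], it costs at
   most [3/8] of the gain [l * eta * D^2]; the bound keeps half of that gain. *)
pose l := eta / (256 * B).
have l0 : 0 < l by rewrite divr_gt0// mulr_gt0.
have lB : l * B = eta / 256 by rewrite /l; field; exact: lt0r_neq0.
have l_small : `|l| * (64 * B) <= 1 by rewrite gtr0_norm//; lra.
have lN_small : `|- l| * (64 * B) <= 1 by rewrite normrN.
have lE : 32 * l ^+ 2 * B = l * (eta / 8).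
  have -> : 32 * l ^+ 2 * B = 32 * l * (l * B) by ring.
  by rewrite lB; field.
have goalE : eta ^+ 2 * D ^+ 2 / (512 * B) = l * eta * D ^+ 2 / 2.
  by rewrite /l; field; exact: lt0r_neq0.
have lhd : l * (eta / 8) * h <= l * (eta / 8) * (2 * D ^+ 2).
  have le0 : 0 <= l * (eta / 8).
    exact: (mulr_ge0 (ltW l0) (divr_ge0 (ltW eta0) (ler0n _ 8))).
  exact: ler_wpM2l le0 _ _ hD.
have D2 : 0 <= l * eta * D ^+ 2.
  exact: (mulr_ge0 (mulr_ge0 (ltW l0) (ltW eta0)) (sqr_ge0 D)).
have D3 : l * eta * D ^+ 2 * eta <= l * eta * D ^+ 2.
  by rewrite -[leRHS]mulr1 ler_wpM2l.
rewrite (eq_bigl (fun f : tp =>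
  (eta * D ^+ 2 < Y f - h) || (eta * D ^+ 2 < h - Y f))); last first.
  by move=> f; rewrite YE ltr_normr opprB.
apply: (@le_trans _ _ (\sum_(f | eta * D ^+ 2 < Y f - h) w f +
    \sum_(f | eta * D ^+ 2 < h - Y f) w f)).
  rewrite big_mkcond [X in X + _]big_mkcond [X in _ + X]big_mkcond -big_split/=.
  apply: ler_sum => f _; have := weight_ge0 (@transcript_law_ge0) f.
  by case: ifP => [/orP[->|->]|_]; do ?case: ifP; lra.
have -> : 2 * expR (- (eta ^+ 2 * D ^+ 2 / (512 * B))) =
  expR (- (eta ^+ 2 * D ^+ 2 / (512 * B))) + expR (- (eta ^+ 2 * D ^+ 2 / (512 * B))) by ring.
have wge := weight_ge0 (@transcript_law_ge0) (K := K).
have Phi0 lam (f : tp) : 0 <= Phi lam (play f s).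
  by apply: prodr_ge0 => c _; apply: prodr_ge0 => i _; exact: expR_ge0.
apply: lerD.
- pose L := (l - 32 * l ^+ 2 * B) * (h + eta * D ^+ 2).
  apply: le_trans (exp_markov (L := L) wge (Phi0 l) (Phi_expect l_small) _) _.
    move=> f hf; apply: le_trans (Phi_ge l (play f s)); rewrite ler_expR /L.
    apply: ler_wpM2l; last by rewrite -/(Y f); lra.
    by rewrite lE -[X in X - _]mulr1 -mulrBr mulr_ge0 ?(ltW l0)//; lra.
  by rewrite -expRD ler_expR goalE /L lE; lra.
- pose L := - ((l + 32 * l ^+ 2 * B) * (h - eta * D ^+ 2)).
  apply: le_trans (exp_markov (L := L) wge (Phi0 (- l)) (Phi_expect lN_small) _) _.
    move=> f hf; apply: le_trans (Phi_ge (- l) (play f s)); rewrite ler_expR /L sqrrN.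
    rewrite -opprD mulNr lerN2; apply: ler_wpM2l; last by rewrite -/(Y f); lra.
    by rewrite addr_ge0 ?(ltW l0)// lE mulr_ge0 ?(ltW l0)//; lra.
  have := mulr_ge0 D2 (ltW eta0).
  by rewrite -expRD ler_expR goalE /L lE opprK; lra.
Qed.

End Tail.

End Concentration.

(** * Runs on a fixed graph *)

Lemma union_bound (R : realDomainType) (T J : finType) (w : T -> R) (bad : pred T)
    (Q : pred J) (big : J -> pred T) (p : R) :
    (forall t, 0 <= w t) -> (forall t, bad t -> exists j, Q j && big j t) ->
    (forall j, Q j -> \sum_(t | big j t) w t <= p) ->
  \sum_(t | bad t) w t <= #|Q|%:R * p.
Proof.
move=> w0 hbad hp.
apply: (@le_trans _ _ (\sum_(j | Q j) \sum_(t | big j t) w t)); last first.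
  by apply: le_trans (ler_sum _ hp) _; rewrite sumr_const mulr_natl.
rewrite (exchange_big_dep predT)//= big_mkcond; apply: ler_sum => t _.
case: ifP => [/hbad[j jt]|_]; last by apply: sumr_ge0.
by rewrite (bigD1 j)//= lerDl sumr_ge0.
Qed.

(** * The online coloring for a fixed tape, with its greedy fallback *)

Definition mex (l : seq nat) : nat := find (fun k => k \notin l) (iota 0 (size l).+1).

Lemma has_mex l : has (fun k => k \notin l) (iota 0 (size l).+1).
Proof.
apply/negPn/negP => /hasPn h.
have sub : {subset iota 0 (size l).+1 <= l} by move=> k /h /negPn.
by have := uniq_leq_size (iota_uniq _ _) sub; rewrite size_iota ltnn.
Qed.

Lemma mex_le l : (mex l <= size l)%N.
Proof. by have := has_mex l; rewrite has_find size_iota ltnS. Qed.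

Lemma mex_notin l : mex l \notin l.
Proof.
have h := has_mex l; have := nth_find 0%N h; rewrite -/(mex l) nth_iota ?ltnS ?mex_le//.
Qed.

Section Coloring.
Variables (R : realType) (n N' : nat) (B th : R) (K : nat).
Local Notation N := N'.+1.
Local Notation edge := {set 'I_n}.
Local Notation tp := (tape edge 'I_N K).

Definition main_color (f : tp) (h : seq edge) (e : edge) : 'I_N := choice f (play f h) e.

Definition main_ok (f : tp) (h : seq edge) (e : edge) : bool :=
  colors B th (state_after B th (play f h)) e (main_color f h e).

(** Colors from [N] on are the fresh ones; subtracting [N] turns the greedy rule into a [mex] over
    the earlier fresh colors at edges meeting [e]. *)
Definition next_color (f : tp) (acc : seq (edge * nat)) (e : edge) : nat :=
  if main_ok f (unzip1 acc) e then nat_of_ord (main_color f (unzip1 acc) e)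
  else (N + mex [seq (p.2 - N)%N | p : edge * nat <- acc &
                  (N <= p.2)%N && ~~ [disjoint p.1 & e]])%N.

Definition coloring (f : tp) (h : seq edge) : seq (edge * nat) :=
  foldl (fun acc e => rcons acc (e, next_color f acc e)) [::] h.

Definition online_color (f : tp) (h : seq edge) (e : edge) : nat :=
  next_color f (coloring f h) e.

Lemma coloring_rcons f h e :
  coloring f (rcons h e) = rcons (coloring f h) (e, online_color f h e).
Proof. by rewrite /coloring foldl_rcons. Qed.

Lemma unzip1_coloring f h : unzip1 (coloring f h) = h.
Proof.
elim/last_ind: h => // h e IH.
by rewrite coloring_rcons /unzip1 map_rcons -/(unzip1 _) IH.
Qed.

End Coloring.

Section Run.
Variables (R : realType) (n N' : nat) (B th : R) (K : nat).
Local Notation N := N'.+1.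
Local Notation edge := {set 'I_n}.
Local Notation st := (state_after B th).
Local Notation tp := (tape edge 'I_N K).
Local Notation w := (weight (transcript_law B th) (K := K)).
Variables (s : seq edge) (Delta : nat).
Local Notation m := (size s).
Local Notation D := (Delta%:R : R).

Hypothesis s_uniq : uniq s.
Hypothesis s_simple : forall e, e \in s -> #|e| = 2%N.
Hypothesis s_size : (m <= K.+1)%N.
Hypothesis s_degree : forall v, (\sum_(e <- s | v \in e) 1 <= Delta)%N.
Hypothesis B_ge1 : 1 <= B.
Hypothesis B_th : 2 * B ^+ 2 <= th.

Definition ed (i : nat) : edge := nth finset.set0 s i.

Definition at_vertex (v : 'I_n) (i : nat) : bool := (i < m)%N && (v \in ed i).

Definition other (v : 'I_n) (i : nat) : 'I_n := odflt v [pick u in ed i :\ v].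

Lemma edE v i : at_vertex v i -> ed i = [set v; other v i] /\ other v i != v.
Proof.
case/andP => im vi; have e2 : #|ed i| = 2%N by apply: s_simple; rewrite mem_nth.
have c1 : #|ed i :\ v| = 1%N by move: e2; rewrite (cardsD1 v) vi => -[].
have [u uE] := cards1P (introT eqP c1).
have -> : other v i = u.
  rewrite /other; case: pickP => [u'|/(_ u)]; rewrite uE inE; first by move/eqP.
  by rewrite eqxx.
split; first by rewrite -(finset.setD1K vi) uE.
by have := finset.set11 u; rewrite -uE !inE => /andP[].
Qed.

Lemma other_inj v i j : at_vertex v i -> at_vertex v j ->
  other v i = other v j -> i = j.
Proof.
move=> ai aj oE; have [ei _] := edE ai; have [ej _] := edE aj.
apply/eqP; case/andP: ai aj => im _ /andP[jm _].
by rewrite -(nth_uniq finset.set0 im jm s_uniq) -/(ed i) -/(ed j) ei ej oE.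
Qed.

Lemma card_at_vertex v : (\sum_(0 <= i < m | at_vertex v i) 1 <= Delta)%N.
Proof.
apply: leq_trans (s_degree v).
rewrite (big_nth finset.set0) big_nat_cond [leqRHS]big_nat_cond.
apply/eq_leq/eq_bigl => i; rewrite /at_vertex /ed.
by case: (i < m)%N; rewrite ?andbF//=.
Qed.

Lemma card_at_vertexR v : \sum_(0 <= i < m | at_vertex v i) (1 : R) <= D.
Proof. by have := card_at_vertex v; rewrite -(ler_nat R) natr_sum. Qed.

Definition local_time v i : nat := #|[set j : 'I_m | at_vertex v j && (j < i)%N]|.

Definition cell v (S : {set 'I_m}) (tau : {ffun 'I_N -> 'I_Delta.+1})
    (i : 'I_m) : pred 'I_N :=
  fun c => [&& i \in S, at_vertex v i & (local_time v i < tau c)%N].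

Definition deviation (f : tp) v S tau : R :=
  \sum_c \sum_(i | cell v S tau i c) (st (take i (play f s)) (other v i) c - 1).

(* A staircase is determined by how long each color stays in it, counted in
   edges at [v]: there are few of them. *)
Lemma staircase_cell v (S : pred nat) (P : nat -> pred 'I_N) :
    staircase (at_vertex v) P ->
  exists S' : {set 'I_m}, exists tau, S' \subset [set i : 'I_m | at_vertex v i] /\
    forall (i : 'I_m) c, cell v S' tau i c = [&& at_vertex v i, S i & P i c].
Proof.
move=> Pst; exists [set i : 'I_m | at_vertex v i && S i].
pose down c := [set j : 'I_m | at_vertex v j && P j c].
have card_act : (#|[set i : 'I_m | at_vertex v i]| <= Delta)%N.
  apply: leq_trans (card_at_vertex v); rewrite -sum1_card big_mkord.
  by apply/eq_leq/eq_bigl => i; rewrite inE.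
have card_down c : (#|down c| < Delta.+1)%N.
  rewrite ltnS; apply: leq_trans card_act; apply/subset_leq_card/fintype.subsetP => j.
  by rewrite !inE => /andP[].
exists [ffun c => inord #|down c|]; split=> [|i c].
  by apply/fintype.subsetP => j; rewrite !inE => /andP[].
rewrite /cell inE ffunE inordK//; case: (boolP (at_vertex v i)) => //= ai; congr (_ && _).
have [Pi|Pi] := boolP (P i c).
- suff : [set j : 'I_m | at_vertex v j && (j < i)%N] \proper down c by move/proper_card.
  apply/properP; split.
    apply/fintype.subsetP => j; rewrite !inE => /andP[aj ji].
    by rewrite aj (Pst c j i (ltnW ji)).
  by exists i; rewrite !inE ?ai ?Pi ?ltnn ?andbF.
- apply/negbTE; rewrite -leqNgt; apply/subset_leq_card/fintype.subsetP => j.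
  rewrite !inE => /andP[aj Pj]; rewrite aj/= ltnNge; apply: contra Pi => ij.
  exact: Pst Pj.
Qed.

(** [S] is restricted to sets of edges at [v], of which there are at most [2 ^ Delta], to keep the
    union bound small. *)
Definition typical (delta : R) (f : tp) : bool :=
  [forall v, forall S : {set 'I_m}, forall tau : {ffun 'I_N -> 'I_Delta.+1},
     (S \subset [set i : 'I_m | at_vertex v i]) ==>
     (`|deviation f v S tau| <= delta)].

(** * A run as an instance of the vertex dynamics *)

Section Vertex.
Variables (f : tp) (v : 'I_n).
Let z := play f s.
Let x i : 'I_N -> R := st (take i z) v.
Let A i : 'I_N -> R := st (take i z) (other v i).
Let k i : 'I_N := choice f (take i z) (ed i).

Definition succeeds i : bool :=
  colors B th (st (take i (play f s))) (ed i) (choice f (take i (play f s)) (ed i)).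

Lemma state_after_take i : (i < m)%N ->
  st (take i.+1 z) = step B th (st (take i z)) (ed i, k i).
Proof.
move=> im; rewrite -state_after_rcons; congr (st _).
rewrite /k /z !take_play (take_nth finset.set0)// play_rcons.
by rewrite -/(ed i).
Qed.

Lemma wtE i c : at_vertex v i ->
  wt B (st (take i z)) (ed i) c = cap B (x i c) * cap B (A i c).
Proof.
by move=> /edE[-> ov]; rewrite /wt big_setU1 ?big_set1// inE eq_sym.
Qed.

Lemma total_wtE i : at_vertex v i ->
  total_wt B (st (take i z)) (ed i) = \sum_c cap B (x i c) * cap B (A i c).
Proof. by move=> ai; apply: eq_bigr => c _; rewrite wtE. Qed.

Let x0 c : x 0 c = 1. Proof. by rewrite /x take0. Qed.

Let A_ge0 i c : 0 <= A i c.
Proof. by have /andP[] := bounded_state_after B_ge1 B_th (take i z) (other v i) c. Qed.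

Let x_idle i : (i < m)%N -> ~~ (at_vertex v i && succeeds i) -> x i.+1 =1 x i.
Proof.
move=> im; rewrite /at_vertex im/= => h c; rewrite /x state_after_take// /step/=.
by rewrite andbC (negbTE h).
Qed.

Let W_succ i : (i < m)%N -> at_vertex v i && succeeds i ->
  th <= \sum_c cap B (x i c) * cap B (A i c).
Proof. by move=> im /andP[ai /andP[/andP[_ h] _]]; rewrite -total_wtE. Qed.

Let k_succ i : (i < m)%N -> at_vertex v i && succeeds i ->
  0 < cap B (x i (k i)) * cap B (A i (k i)).
Proof. by move=> im /andP[ai /andP[_ h]]; rewrite -wtE. Qed.

Let x_succ i : (i < m)%N -> at_vertex v i && succeeds i -> forall c,
  x i.+1 c = if c == k i then 0 else x i c / (1 -
    cap B (x i c) * cap B (A i c) / \sum_c cap B (x i c) * cap B (A i c)).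
Proof.
move=> im /andP[ai si] c; rewrite {1}/x state_after_take// /step/=.
have /andP[_ vi] := ai; have si' : colors B th (st (take i z)) (ed i) (k i) := si.
by rewrite si' vi/= /prob wtE// total_wtE.
Qed.

Let B_gt0 : 0 < B. Proof. exact: lt_le_trans B_ge1. Qed.

Lemma state_gt0_anti i j c : (i <= j)%N -> (j <= m)%N -> 0 < x j c -> 0 < x i c.
Proof. exact: (x_gt0_anti B_gt0 B_th x0 A_ge0 x_idle W_succ x_succ). Qed.

Lemma typical_disc (delta : R) : typical delta f -> disc_le m (at_vertex v) A delta.
Proof.
move=> /forallP/(_ v)/forallP fS S P Pst.
have [S' [tau [sub cE]]] := staircase_cell S Pst.
have /forallP/(_ tau)/implyP/(_ sub) := fS S'; apply: le_trans.
rewrite /deviation (exchange_big_dep (fun i : 'I_m => at_vertex v i && S i))/=.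
  rewrite big_mkord le_eqVlt; apply/orP; left; apply/eqP; congr `|_|.
  apply: eq_bigr => i /andP[ai Si].
  by apply: eq_bigl => c; rewrite cE ai Si.
by move=> c i _; rewrite cE => /and3P[-> ->].
Qed.

Lemma typical_frozen (eps delta : R) i : 0 < eps <= 1 -> B = 8 / eps ->
    th = (1 + eps / 2) * D -> typical delta f -> (i <= m)%N ->
  (\sum_(c | B < x i c) 1) * (eps / 4 * D) <= delta.
Proof.
move=> e1 BE thE tf im.
exact: (card_frozen B_gt0 B_th x0 A_ge0 x_idle W_succ x_succ im e1 BE thE
  (card_at_vertexR v) (typical_disc tf)).
Qed.

Lemma fail_le_of_disc (eps z0 eta : R) : 0 < w f -> 0 < eps <= 10^-1 ->
    B = 8 / eps -> th = (1 + eps / 2) * D -> (1 + eps) * D <= N%:R ->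
    (forall i, (i <= m)%N -> \sum_(c | B < x i c) 1 <= z0 * D) ->
    z0 <= eps ^+ 4 / 10 ^+ 5 -> 0 <= eta <= eps ^+ 5 / 10 ^+ 6 ->
    disc_le m (at_vertex v) (fun i c => cap B (A i c)) (eta * D ^+ 2) ->
  \sum_(0 <= i < m | at_vertex v i && ~~ succeeds i) 1 <= eps ^+ 2 / 1000 * D.
Proof.
move=> wf e01 BE thE NE frozen z0_le eta_le disc_cap.
have W_fail i : (i < m)%N -> at_vertex v i -> ~~ succeeds i ->
    \sum_c cap B (x i c) * cap B (A i c) < th.
  move=> im ai; rewrite -total_wtE// ltNge; apply: contra => hW.
  have law0 : 0 < transcript_law B th (take i z) (ed i) (k i).
    apply: weight_gt0_law wf _; first exact: transcript_law_ge0.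
    rewrite size_takel ?size_play ?(ltnW im)//.
    by rewrite -ltnS (leq_trans im).
  apply: color_law_gt0 law0 _ => //.
  rewrite /admits hW andbT; apply/eqP/s_simple; exact: mem_nth.
exact: (card_fail B_gt0 B_th x0 A_ge0 x_idle W_succ k_succ x_succ e01 BE thE NE
  (card_at_vertexR v) frozen z0_le eta_le disc_cap W_fail).
Qed.

End Vertex.

Lemma fail_le (f : tp) (eps : R) v : 0 < w f -> 0 < eps <= 10^-1 -> B = 8 / eps ->
    th = (1 + eps / 2) * D -> (1 + eps) * D <= N%:R ->
    typical (eps ^+ 7 / 10 ^+ 8 * D ^+ 2) f ->
  \sum_(0 <= i < m | at_vertex v i && ~~ succeeds f i) 1 <= eps ^+ 2 / 1000 * D.
Proof.
move=> wf e01 BE thE NE tf; have /andP[e0 e1] := e01.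
have e01' : 0 < eps <= 1 by rewrite e0/=; lra.
(* The power [7] pays for two losses of [eps^-1]: there are [z D] frozen colors with
   [z = 4 eta / eps], and each costs up to [2 B = 16 / eps] under capping. Hence
   [eta' = eta (1 + 64 / eps^2)], of order [eps^5] as [card_fail] requires. *)
set eta := eps ^+ 7 / 10 ^+ 8 in tf *.
have eta0 : 0 < eta by rewrite divr_gt0 ?exprn_gt0.
have B0 : 0 < B := lt_le_trans ltr01 B_ge1.
have th0 : 0 < th by apply: lt_le_trans B_th; rewrite mulr_gt0// exprn_gt0.
have D0 : 0 < D by move: th0; rewrite thE pmulr_rgt0//; lra.
pose A i : 'I_N -> R := st (take i (play f s)) (other v i).
pose z := 4 * eta / eps.
have frozen u i : (i <= m)%N ->
    \sum_(c | B < st (take i (play f s)) u c) 1 <= z * D.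
  move=> im; have := typical_frozen u e01' BE thE tf im.
  have -> : eta * D ^+ 2 = z * D * (eps / 4 * D) by rewrite /z; field; exact: lt0r_neq0.
  by rewrite ler_pM2r// mulr_gt0// divr_gt0.
have A2B i c : 0 <= A i c <= 2 * B by exact: bounded_state_after.
pose eta' := eta + 2 * B * z.
have discA : disc_le m (at_vertex v) A (eta * D ^+ 2) := typical_disc tf.
have z0 : 0 <= z by rewrite divr_ge0 ?mulr_ge0// ltW.
have disc_cap : disc_le m (at_vertex v) (fun i c => cap B (A i c)) (eta' * D ^+ 2).
  move=> S P Pst; pose loss i := \sum_(c | P i c) (A i c - cap B (A i c)).
  have lossE i : \sum_(c | P i c) (cap B (A i c) - 1) =
      \sum_(c | P i c) (A i c - 1) - loss i.
    by rewrite /loss -sumrB; apply: eq_bigr => c _; ring.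
  rewrite (eq_bigr (fun i => \sum_(c | P i c) (A i c - 1) - loss i)) => [|i _];
    last exact: lossE.
  rewrite sumrB; apply: le_trans (ler_normB _ _) _.
  rewrite /eta' mulrDl lerD//; first exact: discA.
  have loss0 i : 0 <= loss i.
    apply: sumr_ge0 => c _; rewrite subr_ge0 cap_le//; by have /andP[] := A2B i c.
  have loss_le i : (i < m)%N -> loss i <= 2 * B * (z * D).
    move=> im; have := frozen (other v i) i (ltnW im).
    have B2 : 0 <= 2 * B by rewrite mulr_ge0// ltW.
    move=> /(ler_wpM2l B2); apply: le_trans; rewrite mulr_sumr /loss.
    rewrite big_mkcond [leRHS]big_mkcond/=; apply: ler_sum => c _.
    have /andP[a0 a2] := A2B i c; rewrite /cap -[st _ _ c]/(A i c) [A i c <= B]leNgt mulr1.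
    by case: (P i c); case: (B < A i c) => //=; rewrite ?subrr ?subr0.
  have p0 : 0 <= 2 * B * (z * D).
    exact: (mulr_ge0 (mulr_ge0 (ler0n _ 2) (ltW B0)) (mulr_ge0 z0 (ltW D0))).
  rewrite ger0_norm ?sumr_ge0//.
  apply: (@le_trans _ _ (\sum_(0 <= i < m | at_vertex v i) 2 * B * (z * D))).
    rewrite big_nat_cond [leRHS]big_nat_cond big_mkcond [leRHS]big_mkcond/=.
    apply: ler_sum => i _; case: (boolP (i < m)%N) => im //=.
    by case: (at_vertex v i) => //=; case: ifP => _ //; exact: loss_le.
  rewrite (eq_bigr (fun _ => 2 * B * (z * D) * 1)) => [|i _]; last by rewrite mulr1.
  rewrite -mulr_sumr.
  have -> : 2 * B * z * D ^+ 2 = 2 * B * (z * D) * D by ring.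
  apply: ler_wpM2l => //; exact: card_at_vertexR.
have e5 : 0 < eps ^+ 5 by rewrite exprn_gt0.
have eta5 : eta = eps ^+ 2 * (eps ^+ 5 / 10 ^+ 8) by rewrite /eta; field.
have e2 : eps ^+ 2 <= 1 by rewrite exprn_ile1// ltW//; lra.
have z_le : z <= eps ^+ 4 / 10 ^+ 5.
  have -> : z = eps ^+ 4 * (4 / 10 ^+ 8 * eps ^+ 2) by rewrite /z /eta; field; lra.
  by apply: ler_wpM2l; [rewrite exprn_ge0// ltW|lra].
have eta'_le : 0 <= eta' <= eps ^+ 5 / 10 ^+ 6.
  have -> : eta' = eps ^+ 5 / 10 ^+ 8 * (eps ^+ 2 + 64).
    by rewrite /eta' /z BE /eta; field; lra.
  rewrite mulr_ge0 ?divr_ge0 ?(ltW e5) ?addr_ge0 ?sqr_ge0//=.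
  have := ler_wpM2l (ltW e5) e2; lra.
exact: (fail_le_of_disc wf e01 BE thE NE (frozen v) z_le eta'_le disc_cap).
Qed.

(** * Properness and number of colors of the output *)

Section Output.
Variable f : tp.

Definition out (e : edge) : nat := online_color B th f (take (index e s) s) e.

Definition fails (e : edge) : bool := ~~ main_ok B th f (take (index e s) s) e.

Lemma succeedsE i : (i < m)%N -> succeeds f i = ~~ fails (ed i).
Proof.
by move=> im; rewrite /fails negbK /ed index_uniq// /main_ok /succeeds take_play.
Qed.

Lemma coloring_take i : (i <= m)%N ->
  coloring B th f (take i s) = [seq (e, out e) | e <- take i s].
Proof.
elim: i => [|i IH] im; first by rewrite take0.
rewrite (take_nth finset.set0)// coloring_rcons IH ?(ltnW im)// map_rcons.
by rewrite /out index_uniq.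
Qed.

Lemma out_fail e : e \in s -> fails e ->
  out e = (N + mex [seq (out e' - N)%N | e' <- take (index e s) s &
                     (N <= out e')%N && ~~ [disjoint e' & e]])%N.
Proof.
move=> es; rewrite /fails => /negbTE fe; rewrite {1}/out /online_color /next_color.
rewrite unzip1_coloring fe coloring_take ?index_size//.
by rewrite filter_map -map_comp.
Qed.

Lemma out_main e : ~~ fails e -> out e = main_color f (take (index e s) s) e.
Proof.
by rewrite negbK /out /online_color /next_color unzip1_coloring => ->.
Qed.

Lemma fails_out e : e \in s -> fails e = (N <= out e)%N.
Proof.
move=> es; case: (boolP (fails e)) => fe; first by rewrite (out_fail es fe) leq_addr.
by rewrite out_main// leqNgt ltn_ord.
Qed.

Lemma main_color_alive i v : at_vertex v i -> succeeds f i ->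
  0 < st (take i (play f s)) v (choice f (take i (play f s)) (ed i)).
Proof.
move=> ai /andP[_]; rewrite (wtE f _ ai) => h.
have := (bounded_state_after B_ge1 B_th (take i (play f s)) v
  (choice f (take i (play f s)) (ed i))).
case/andP; rewrite le_eqVlt => /predU1P[x0|//].
by move: h; rewrite -x0 /cap; case: ifP; rewrite mul0r ltxx.
Qed.

(** Equal colors would be both fresh or both below [N]. In the first case [mex] avoids the earlier
    color; in the second, the weight of that color at [v] is [0] from [e] on, while only colors of
    positive weight are given. *)
Lemma out_lt_neq e e' v : e \in s -> e' \in s -> (index e s < index e' s)%N ->
  v \in e -> v \in e' -> out e <> out e'.
Proof.
move=> es e's lt_ee' ve ve' oE.
have fE : fails e' = fails e by rewrite !fails_out// oE.
case: (boolP (fails e')) => fe'.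
  have := mex_notin [seq (out e0 - N)%N | e0 <- take (index e' s) s &
     (N <= out e0)%N && ~~ [disjoint e0 & e']].
  set l := [seq _ | _ <- _ & _].
  have := out_fail e's fe'; rewrite -/l -oE => oE' /negP; apply.
  apply/mapP; exists e; last by rewrite oE' addKn.
  rewrite mem_filter -fails_out// -fE fe'/=; apply/andP; split.
    by apply/pred0Pn; exists v; rewrite /= ve ve'.
  rewrite -(nth_index finset.set0 es) -(nth_take finset.set0 lt_ee').
  by apply: mem_nth; rewrite size_takel ?index_size.
have fe : ~~ fails e by rewrite -fE.
have im : (index e s < m)%N by rewrite index_mem.
have jm : (index e' s < m)%N by rewrite index_mem.
have ei : ed (index e s) = e by rewrite /ed nth_index.
have ej : ed (index e' s) = e' by rewrite /ed nth_index.
have ai : at_vertex v (index e s) by rewrite /at_vertex im ei.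
have aj : at_vertex v (index e' s) by rewrite /at_vertex jm ej.
have si : succeeds f (index e s) by rewrite succeedsE// ei.
have sj : succeeds f (index e' s) by rewrite succeedsE// ej.
have cE : choice f (take (index e s) (play f s)) e =
    choice f (take (index e' s) (play f s)) e'.
  apply/val_inj; move: oE; rewrite !out_main// /main_color !take_play; exact.
have := main_color_alive aj sj; rewrite ej -cE.
move/(state_gt0_anti lt_ee' (ltnW jm)).
rewrite state_after_take// /step/= ei.
have -> : colors B th (st (take (index e s) (play f s))) e
    (choice f (take (index e s) (play f s)) e).
  by move: si; rewrite /succeeds ei.
by rewrite ve eqxx ltxx.
Qed.

Lemma out_proper e e' v : e \in s -> e' \in s -> e != e' ->
  v \in e -> v \in e' -> out e <> out e'.
Proof.
move=> es e's ee' ve ve'.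
case: (ltngtP (index e s) (index e' s)) => [h|h|h].
- exact: (out_lt_neq es e's h ve ve').
- by move=> oE; apply: (out_lt_neq e's es h ve' ve).
- by move: ee'; rewrite -(nth_index finset.set0 es) h nth_index// eqxx.
Qed.

(** The [mex] is at most the number of earlier failed edges at the two ends of [e], hence at most
    [2 * phi]. *)
Lemma out_lt (phi : nat) e : e \in s ->
    (forall v, \sum_(e' <- s | (v \in e') && fails e') 1 <= phi)%N ->
  (out e < N + (2 * phi).+1)%N.
Proof.
move=> es hphi; case: (boolP (fails e)) => fe; last first.
  by rewrite out_main// (leq_trans (ltn_ord _))// leq_addr.
rewrite (out_fail es fe) ltn_add2l ltnS; apply: leq_trans (mex_le _) _.
rewrite size_map size_filter.
apply: (@leq_trans (\sum_(u in e) \sum_(e' <- s | (u \in e') && fails e') 1)%N).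
  rewrite (exchange_big_dep predT)//=.
  rewrite -sum1_count.
  apply: (@leq_trans (\sum_(e' <- s | (N <= out e')%N && ~~ [disjoint e' & e]) 1)%N).
    by rewrite -[in leqRHS](cat_take_drop (index e s) s) big_cat/= leq_addr.
  rewrite big_mkcond/= big_seq [leqRHS]big_seq; apply: leq_sum => e' e's.
  case: ifP => // /andP[ne /pred0Pn[u /andP[/= ue' ue]]].
  by rewrite (bigD1 u)//= ue ue'/= fails_out.
rewrite -(s_simple es) -sum_nat_const; apply: leq_sum => u _; exact: hphi.
Qed.

Lemma fail_sumE v :
  \sum_(0 <= i < m | at_vertex v i && ~~ succeeds f i) (1 : R) =
  (\sum_(e <- s | (v \in e) && fails e) 1)%N%:R.
Proof.
rewrite natr_sum (big_nth finset.set0) big_nat_cond [RHS]big_nat_cond.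
apply: eq_bigl => i; rewrite /at_vertex -/(ed i).
by case: (boolP (i < m)%N) => im /=; rewrite ?andbF//= succeedsE// negbK.
Qed.

End Output.

(** Union bound over the vertex, [S] and [tau]. Each deviation involves at most
    [N * Delta <= 2 Delta^2] pairs, as [discrepancy_tail] requires. *)
Lemma typical_tail (eta : R) : 0 < eta <= 1 -> (N <= 2 * Delta)%N ->
  \sum_(f : tp | ~~ typical (eta * D ^+ 2) f) w f <=
    (n * 2 ^ Delta * Delta.+1 ^ N)%:R * (2 * expR (- (eta ^+ 2 * D ^+ 2 / (512 * B)))).
Proof.
move=> eta01 N2; set p := 2 * _.
have w0 (f : tp) : 0 <= w f := weight_ge0 (@transcript_law_ge0 R n N' B th B_ge1 B_th) f.
have p0 : 0 <= p := mulr_ge0 (ler0n R 2) (expR_ge0 _).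
pose small v S tau (f : tp) := `|deviation f v S tau| <= eta * D ^+ 2.
have tail v S tau : \sum_(f | ~~ small v S tau f) w f <= p.
  rewrite (eq_bigl (fun f : tp => eta * D ^+ 2 < `|\sum_c \sum_(i | cell v S tau i c)
    (st (take i (play f s)) (other v i) c - 1)|)) => [|f]; last by rewrite -ltNge.
  apply: discrepancy_tail => //.
    move=> i j c d /and3P[_ ai _] /and3P[_ aj _] oE.
    by apply/val_inj; exact: other_inj ai aj oE.
  apply: (@le_trans _ _ (\sum_(c : 'I_N) D)).
    apply: ler_sum => c _; apply: le_trans (card_at_vertexR v).
    rewrite big_mkord big_mkcond [leRHS]big_mkcond/=; apply: ler_sum => i _.
    by rewrite /cell; case: (at_vertex v i); rewrite ?andbF//=; case: ifP; rewrite ?ler01.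
  rewrite sumr_const card_ord -[_ *+ N]mulr_natl expr2 mulrA ler_wpM2r//.
  by rewrite -natrM ler_nat.
rewrite -mulnA natrM -mulrA -[X in X%:R * _]card_ord.
apply: (union_bound (Q := predT)
  (big := fun v f => ~~ [forall S : {set 'I_m}, forall tau : {ffun 'I_N -> 'I_Delta.+1},
     (S \subset [set i : 'I_m | at_vertex v i]) ==> small v S tau f])) => //.
  by move=> f /forallPn[v hv]; exists v.
move=> v _; pose acts := powerset [set i : 'I_m | at_vertex v i].
have card_acts : (#|acts| <= 2 ^ Delta)%N.
  rewrite card_powerset leq_pexp2l//; apply: leq_trans (card_at_vertex v).
  rewrite -sum1_card big_mkord; by apply/eq_leq/eq_bigl => i; rewrite inE.
rewrite natrM -mulrA; apply: (@le_trans _ _ (#|acts|%:R * ((Delta.+1 ^ N)%:R * p))).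
  apply: (union_bound (Q := mem acts) (big := fun S f =>
    ~~ [forall tau : {ffun 'I_N -> 'I_Delta.+1}, small v S tau f])) => //.
    move=> f /forallPn[S /forallPn[tau]]; rewrite negb_imply => /andP[SA h].
    exists S; rewrite /= /acts powersetE SA/=; apply/forallPn; by exists tau.
  move=> S _; have <- : #|{ffun 'I_N -> 'I_Delta.+1}| = (Delta.+1 ^ N)%N.
    by rewrite card_ffun !card_ord.
  apply: (union_bound (Q := predT) (big := fun tau f => ~~ small v S tau f)) => //.
  by move=> f /forallPn[tau h]; exists tau.
by apply: ler_wpM2r; rewrite ?ler_nat// mulr_ge0.
Qed.

End Run.

(** * The algorithm and its parameters *)

Section Algorithm.
Local Open Scope classical_set_scope.
Variables (R : realType) (n Delta N' : nat) (B th : R).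
Local Notation N := N'.+1.
Local Notation edge := {set 'I_n}.
Local Notation K := #|edge|.
Local Notation tp := (tape edge 'I_N K).
Local Notation w := (weight (transcript_law B th) (K := K)).
Hypothesis B_ge1 : 1 <= B.
Hypothesis B_th : 2 * B ^+ 2 <= th.

Definition default_tape : tp := [ffun=> ord0].

Let w_ge0 (f : tp) : 0 <= w f.
Proof. by apply: weight_ge0; exact: transcript_law_ge0. Qed.

Let w_sum1 : \sum_(f : tp) w f = 1.
Proof. by apply: weight_sum1 => z e; exact: transcript_law_sum1. Qed.

Definition tape_color (h : seq edge) (e : edge) (k : nat) : nat :=
  online_color B th (decode default_tape k) h e.

Lemma measurable_tape_color h e : measurable_fun setT (tape_color h e).
Proof. by []. Qed.

Definition tape_algorithm : online_algorithm R n Delta :=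
  @OnlineAlgorithm R n Delta _ _ (finite_probability default_tape w_ge0 w_sum1)
    tape_color measurable_tape_color.

Section Run.
Variables (E : {set edge}) (s : seq edge).
Hypothesis E_simple : simple_graph E.
Hypothesis E_degree : max_degree E = Delta.
Hypothesis s_arrival : arrival_order E s.

Let s_uniq : uniq s. Proof. by case: s_arrival. Qed.
Let s_mem e : (e \in s) = (e \in E). Proof. by case: s_arrival. Qed.
Let s_simple e : e \in s -> #|e| = 2%N.
Proof. by rewrite s_mem => /E_simple. Qed.
Let s_size : (size s <= K.+1)%N.
Proof. by rewrite -(card_uniqP s_uniq) (leq_trans (max_card _)). Qed.
Let s_degree v : (\sum_(e <- s | v \in e) 1 <= Delta)%N.
Proof.
rewrite -E_degree /max_degree; apply: leq_trans (leq_bigmax v).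
rewrite /degree sum1_count -size_filter -(card_uniqP (filter_uniq _ s_uniq)).
by apply/eq_leq/eq_card => e; rewrite mem_filter inE s_mem andbC.
Qed.

Lemma outputE (k : seed tape_algorithm) e :
  output s k e = out B th s (decode default_tape k) e.
Proof. by []. Qed.

Lemma output_proper (k : seed tape_algorithm) : proper_edge_coloring E (output s k).
Proof.
move=> e e' v eE e'E ee' ve ve'; rewrite !outputE.
by apply: (out_proper s_uniq s_simple B_ge1 B_th _ _ ee' ve ve'); rewrite s_mem.
Qed.

Lemma nb_colors_le (f : tp) (phi : nat) :
    (forall v, \sum_(e <- s | (v \in e) && fails B th s f e) 1 <= phi)%N ->
  (nb_colors E (out B th s f) <= N + (2 * phi).+1)%N.
Proof.
move=> hphi; rewrite -[leqRHS](size_iota 0); apply: uniq_leq_size; first exact: undup_uniq.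
move=> c; rewrite mem_undup => /mapP[e]; rewrite mem_enum -s_mem => es ->.
rewrite mem_iota/= add0n; exact: (out_lt s_uniq s_simple es hphi).
Qed.

Lemma nb_colors_trivial (f : tp) :
  (nb_colors E (out B th s f) <= N + (2 * Delta).+1)%N.
Proof.
apply: nb_colors_le => v; apply: leq_trans (s_degree v).
by rewrite big_mkcondr/=; apply: leq_sum => e _; case: ifP.
Qed.

Lemma seed_lawE (M : R) :
  seed_law tape_algorithm [set k | (nb_colors E (output s k))%:R <= M] =
  (\sum_(f : tp | (nb_colors E (out B th s f))%:R <= M) w f)%:E.
Proof.
exact: (finite_lawE default_tape w_ge0
  (fun f : tp => (nb_colors E (out B th s f))%:R <= M)).
Qed.

Lemma seed_law_typical (eps M : R) : 0 < eps <= 10^-1 -> B = 8 / eps ->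
    th = (1 + eps / 2) * Delta%:R -> (1 + eps) * Delta%:R <= N%:R ->
    N%:R + 1 + eps ^+ 2 / 500 * Delta%:R <= M ->
  1 - \sum_(f : tp | ~~ typical B th s Delta (eps ^+ 7 / 10 ^+ 8 * Delta%:R ^+ 2) f) w f <=
  \sum_(f : tp | (nb_colors E (out B th s f))%:R <= M) w f.
Proof.
move=> e01 BE thE NE ME.
rewrite lerBlDr -[leLHS]w_sum1 (bigID (fun f : tp => (nb_colors E (out B th s f))%:R <= M))/=.
rewrite lerD2l big_mkcond [leRHS]big_mkcond; apply: ler_sum => f _.
case: ifPn => h; last by case: ifP.
(* Only tapes of positive weight obey the bound on failures; the others contribute nothing. *)
case: ifPn => // /negPn tf; apply: contraNT h; rewrite -ltNge => w0.
have /truncn_itv : 0 <= eps ^+ 2 / 1000 * Delta%:R.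
  exact: (mulr_ge0 (divr_ge0 (sqr_ge0 eps) (ler0n _ _)) (ler0n _ _)).
move: (Num.truncn _) => phi /andP[phi_le phi_lt].
have phi_ge v : (\sum_(e <- s | (v \in e) && fails B th s f e) 1 <= phi)%N.
  rewrite -ltnS -(ltr_nat R); apply: le_lt_trans phi_lt; rewrite -fail_sumE//.
  exact: (fail_le s_simple s_size s_degree B_ge1 B_th v w0 e01).
apply: le_trans ME; apply: (@le_trans _ _ (N + (2 * phi).+1)%:R).
  by rewrite ler_nat; exact: nb_colors_le.
rewrite natrD -[(2 * phi).+1]addn1 natrD natrM; lra.
Qed.

Lemma seed_law_ge (eps M : R) : 0 < eps <= 10^-1 -> B = 8 / eps ->
    th = (1 + eps / 2) * Delta%:R -> (1 + eps) * Delta%:R <= N%:R ->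
    (N <= 2 * Delta)%N -> N%:R + 1 + eps ^+ 2 / 500 * Delta%:R <= M ->
  ((1 - (n * 2 ^ Delta * Delta.+1 ^ N)%:R *
     (2 * expR (- ((eps ^+ 7 / 10 ^+ 8) ^+ 2 * Delta%:R ^+ 2 / (512 * B)))))%:E <=
  seed_law tape_algorithm [set k | ((nb_colors E (output s k))%:R <= M)%R])%E.
Proof.
move=> e01 BE thE NE N2 ME; rewrite seed_lawE lee_fin.
apply: le_trans (seed_law_typical e01 BE thE NE ME); rewrite lerD2l lerN2.
apply: (typical_tail s_uniq s_simple s_size s_degree B_ge1 B_th _ N2).
have /andP[e0 e1] := e01; rewrite divr_gt0 ?exprn_gt0//=.
rewrite ler_pdivrMr ?exprn_gt0// mul1r.
have : eps ^+ 7 <= 1 by apply: exprn_ile1; [exact: ltW|lra].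
lra.
Qed.

Lemma seed_law_trivial (M : R) : (N + (2 * Delta).+1)%:R <= M ->
  seed_law tape_algorithm [set k | (nb_colors E (output s k))%:R <= M] = 1%E.
Proof.
move=> ME; rewrite seed_lawE; congr (_%:E); rewrite -[RHS]w_sum1.
apply: eq_bigl => f; apply: le_trans ME; by rewrite ler_nat nb_colors_trivial.
Qed.

End Run.
End Algorithm.

(** * Elementary estimates *)

Section Numerics.
Variable R : realType.
Implicit Types a b : R.

Lemma expr_ge1D a k : 0 <= a -> 1 + a ^+ k.+1 <= (1 + a) ^+ k.+1.
Proof.
move=> a0; elim: k => [|k IH]; first by rewrite !expr1.
have p0 : 0 <= a ^+ k.+1 by rewrite exprn_ge0.
rewrite exprS [leRHS]exprS; apply: le_trans (ler_wpM2l _ IH); last by lra.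
nra.
Qed.

(** The crude estimate [Delta + 1 <= (1 + a)^16 <= expR (16 a)] replaces [ln Delta] by a multiple of
    [Delta^(1/16)]; the exponent then is [O(a^17)] plus [ln n]. *)
Lemma union_count_le a (n Delta N : nat) : (0 < n)%N -> 0 <= a ->
    Delta%:R = a ^+ 16 ->
  (n * 2 ^ Delta * Delta.+1 ^ N)%:R <= expR (ln n%:R + Delta%:R + 16 * a * N%:R).
Proof.
move=> n0 a0 DE; rewrite !natrM !natrX !expRD lnK ?posrE ?ltr0n//.
have e2 : (2 : R) ^+ Delta <= expR Delta%:R.
  rewrite -[X in expR X]mulr1 expRM_natl; apply: lerXn2r; rewrite ?nnegrE ?expR_ge0//.
  by have := expR_ge1Dx (1 : R); lra.
have eD : (Delta.+1%:R : R) ^+ N <= expR (16 * a * N%:R).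
  rewrite expRM_natr; apply: lerXn2r; rewrite ?nnegrE ?expR_ge0//.
  rewrite -natr1 DE addrC; apply: le_trans (expr_ge1D 15 a0) _.
  rewrite expRM_natl; apply: lerXn2r; rewrite ?nnegrE ?expR_ge0 ?addr_ge0//.
  exact: expR_ge1Dx.
apply: ler_pM => //; rewrite ?mulr_ge0 ?exprn_ge0//.
by apply: ler_wpM2l.
Qed.

Lemma ln2_ge_half : 2^-1 <= ln 2 :> R.
Proof.
rewrite -[leLHS]expRK ler_ln ?posrE ?expR_gt0//.
have -> : (2^-1 : R) = 4^-1 + 4^-1 by field.
have := expR_le_quadratic (lexx (4^-1 : R)); have := expR_ge0 (4^-1 : R).
rewrite expRD; set t := expR _ => t0 t1.
have t2 : t <= 7 / 5 by rewrite (le_trans t1)// expr2; lra.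
by have := ler_pM t0 t0 t2 t2; lra.
Qed.

End Numerics.

(** * Choice of the parameters *)

Section Regime.
Variables (R : realType) (n Delta : nat) (a b : R).
Hypothesis n_ge2 : (2 <= n)%N.
Hypothesis a_ge1 : 1 <= a.
Hypothesis a_eq : Delta%:R = a ^+ 16.
Hypothesis b_ge : 2^-1 <= b.
Hypothesis b_eq : ln n%:R = b ^+ 32.

(** Chosen so that [eps * Delta] is [100 Delta^(15/16) (ln n)^(1/32)], the order of the allowed
    excess. *)
Let eps := 100 * b / a.
Hypothesis eps_le : eps <= 10^-1.

Let a_gt0 : 0 < a. Proof. exact: lt_le_trans a_ge1. Qed.
Let b_gt0 : 0 < b. Proof. by apply: lt_le_trans b_ge; rewrite invr_gt0. Qed.
Let eps_gt0 : 0 < eps. Proof. by rewrite divr_gt0// mulr_gt0. Qed.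
Let eps_a : eps * a = 100 * b. Proof. by rewrite /eps divfK// lt0r_neq0. Qed.
Let ab : 500 <= a.
Proof. have := ler_wpM2r (ltW a_gt0) eps_le; rewrite eps_a; have := b_ge; lra. Qed.

Let a_pow k : 1 <= a ^+ k. Proof. exact: exprn_ege1. Qed.

Let D_ge : 500 <= (Delta%:R : R).
Proof. by rewrite a_eq exprS; have := a_pow 15; have := ab; nra. Qed.

Lemma eps_D : eps * Delta%:R = 100 * (a ^+ 15 * b).
Proof. by rewrite a_eq exprS mulrA eps_a; ring. Qed.

Lemma cap_ge1 : 1 <= 8 / eps.
Proof. by rewrite ler_pdivlMr// mul1r; have := eps_le; lra. Qed.

Lemma cap_threshold : 2 * (8 / eps) ^+ 2 <= (1 + eps / 2) * Delta%:R.
Proof.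
have -> : 2 * (8 / eps) ^+ 2 = 128 / eps ^+ 2 by field; exact: lt0r_neq0.
rewrite ler_pdivrMr ?exprn_gt0//.
have h : 128 <= Delta%:R * eps ^+ 2.
  have -> : Delta%:R * eps ^+ 2 = (100 * b) ^+ 2 * a ^+ 14.
    by rewrite -eps_a a_eq; ring.
  have : 50 <= 100 * b by have := b_ge; lra.
  by have := a_pow 14; nra.
apply: le_trans h _; rewrite ler_wpM2r ?sqr_ge0//.
by have := eps_gt0; have := D_ge; nra.
Qed.

Let N' := Num.truncn ((1 + eps) * Delta%:R).

Lemma palette_bounds :
  (1 + eps) * Delta%:R <= (N'.+1%:R : R) <= (1 + eps) * Delta%:R + 1.
Proof.
have p0 : 0 <= (1 + eps) * (Delta%:R : R).
  by apply: mulr_ge0 (ler0n _ _); have := eps_gt0; lra.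
have := truncn_itv p0; rewrite -/N' => /andP[h1 /ltW ->].
by rewrite -natr1 lerD2r.
Qed.

Lemma palette_le : (N'.+1 <= 2 * Delta)%N.
Proof.
rewrite -(ler_nat R) natrM; have /andP[_ h] := palette_bounds.
apply: le_trans h _; have := ler_wpM2r (ler0n R Delta) eps_le.
have := D_ge; lra.
Qed.

(** [eps^15 Delta^2] is a constant times [b^15 a^17]. This beats [ln n = b^32] because [b <= a], and
    the [O(a^17)] of the union bound because [b >= 1/2] and the constant is large. *)
Lemma tail_le_inv :
  (n * 2 ^ Delta * Delta.+1 ^ N'.+1)%:R * (2 * expR (-
    ((eps ^+ 7 / 10 ^+ 8) ^+ 2 * Delta%:R ^+ 2 / (512 * (8 / eps))))) <= (n%:R : R)^-1.
Proof.
set Q := (X in expR (- X)).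
have n0 : (0 < n)%N by apply: leq_trans n_ge2.
have e0 : 0 <= expR (- Q) := expR_ge0 _.
have two : 2 <= expR (1 : R) by have := expR_ge1Dx (1 : R); lra.
apply: le_trans (ler_pM (ler0n _ _) (mulr_ge0 (ler0n R 2) e0)
  (union_count_le N'.+1 n0 (ltW a_gt0) a_eq) (ler_wpM2r e0 two)) _.
have -> : (n%:R^-1 : R) = expR (- ln n%:R) by rewrite expRN lnK// posrE ltr0n.
rewrite -!expRD ler_expR.
have QE : Q = 10 ^+ 14 / 2 ^+ 12 * (b ^+ 15 * a ^+ 17).
  rewrite /Q a_eq /eps; field.
  by rewrite !lt0r_neq0.
have b15 : (2 ^+ 15)^-1 <= b ^+ 15.
  by rewrite -exprVn; apply: lerXn2r; rewrite ?nnegrE ?invr_ge0 ?(ltW b_gt0).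
have h1 : b ^+ 32 <= b ^+ 15 * a ^+ 17.
  have -> : b ^+ 32 = b ^+ 15 * b ^+ 17 by rewrite -exprD.
  apply: ler_wpM2l; first by rewrite exprn_ge0// ltW.
  apply: lerXn2r; rewrite ?nnegrE ?(ltW a_gt0) ?(ltW b_gt0)//.
  have := ler_wpM2r (ltW a_gt0) eps_le; rewrite eps_a; have := b_gt0; lra.
have h2 : (2 ^+ 15)^-1 * a ^+ 17 <= b ^+ 15 * a ^+ 17.
  by apply: ler_wpM2r => //; have := a_pow 17; lra.
have aD : a * Delta%:R = a ^+ 17 by rewrite a_eq -exprS.
have aN : a * N'.+1%:R <= a * (2 * Delta%:R).
  by apply: ler_wpM2l; [exact: ltW|rewrite -natrM ler_nat palette_le].
have Da : Delta%:R <= a ^+ 17.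
  by rewrite -aD; have := D_ge; have := a_ge1; nra.
have a17 := a_pow 17.
rewrite b_eq QE; set u := b ^+ 15 * a ^+ 17 in h1 h2 *.
have -> : 16 * a * N'.+1%:R = 16 * (a * N'.+1%:R) by ring.
have aN2 : a * (2 * Delta%:R) = 2 * a ^+ 17 by rewrite -aD; ring.
rewrite aN2 in aN.
lra.
Qed.

End Regime.

(** * The two regimes and the final guarantee *)

Lemma exists_online_algorithm (R : realType) (n Delta : nat) :
  exists A : online_algorithm R n Delta,
  forall (E : {set {set 'I_n}}) (s : seq {set 'I_n}),
    (2 <= n)%N -> (1 <= Delta)%N ->
    simple_graph E -> max_degree E = Delta -> arrival_order E s ->
    (forall w : seed A, proper_edge_coloring E (output s w)) /\
    ((1 - 1 / n%:R `^ 1)%:E <=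
      seed_law A
        [set w : seed A |
          ((nb_colors E (output s w))%:R <=
            Delta%:R +
            30 * 100 * Delta%:R `^ (15 / 16) * ln n%:R `^ (1 / 32) :> R)%R]%classic)%E.
Proof.
have B1 : 1 <= 1 :> R by [].
have B2 : 2 * 1 ^+ 2 <= 2 :> R by rewrite expr1n mulr1.
case: (boolP ((2 <= n) && (1 <= Delta))%N) => [/andP[n2 D1]|h]; last first.
  (* Any algorithm serves for the excluded values of [n] and [Delta]. *)
  exists (tape_algorithm n Delta 0 B1 B2) => E s n2 D1.
  by move: h; rewrite n2 D1.
set M := Delta%:R + _.
pose a : R := Delta%:R `^ (1 / 16); pose b : R := ln n%:R `^ (1 / 32).
have n0 : (0 : R) < n%:R by rewrite ltr0n; apply: leq_trans n2.
have D0 : (1 : R) <= Delta%:R by rewrite ler1n.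
have L_ge : 2^-1 <= ln (n%:R : R).
  by apply: le_trans (ln2_ge_half R) _; rewrite ler_ln ?posrE// ler_nat.
have a16 : Delta%:R = a ^+ 16.
  by rewrite -powR_mulrn ?powR_ge0// -powRrM divfK// powRr1// ler0n.
have b32 : ln n%:R = b ^+ 32.
  rewrite -powR_mulrn ?powR_ge0// -powRrM divfK// powRr1//.
  by apply: le_trans L_ge; rewrite invr_ge0.
have a15 : Delta%:R `^ (15 / 16) = a ^+ 15 :> R.
  by rewrite -powR_mulrn ?powR_ge0// -powRrM; congr (_ `^ _); field.
have a0 : 0 <= a := powR_ge0 _ _.
have b0 : 0 <= b := powR_ge0 _ _.
have a1 : 1 <= a.
  by rewrite leNgt; apply/negP => alt; move: D0; rewrite a16 leNgt exprn_ilt1.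
have b_ge : 2^-1 <= b.
  rewrite leNgt; apply/negP => blt; move: L_ge; rewrite b32 leNgt => /negP; apply.
  apply: le_lt_trans (blt); rewrite exprS -[leRHS]mulr1 ler_wpM2l//.
  by apply: exprn_ile1 => //; move: blt; lra.
have b_gt0 : 0 < b by apply: lt_le_trans b_ge; rewrite invr_gt0.
have a_gt0 : 0 < a by apply: lt_le_trans a1.
pose eps := 100 * b / a.
have eps_gt0 : 0 < eps by rewrite divr_gt0// mulr_gt0.
have ME : M = Delta%:R + 30 * (eps * Delta%:R).
  by rewrite /M a15 -/b (eps_D b a1 a16); ring.
case: (leP eps 10^-1) => eps_le.
(* This absorbs the additive constants that come from rounding the palette size and from the last
   greedy color. *)
- have eD : 50 <= eps * Delta%:R.
    rewrite (eps_D b a1 a16); have := exprn_ege1 15 a1; move: b_ge; nra.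
  exists (tape_algorithm n Delta (Num.truncn ((1 + eps) * Delta%:R))
    (cap_ge1 a1 b_ge eps_le) (cap_threshold a1 a16 b_ge eps_le)).
  move=> E s _ _ E_simple E_degree s_arrival; split.
    move=> w; exact: (output_proper E_simple s_arrival).
  have e01 : 0 < eps <= 10^-1 by rewrite eps_gt0.
  have /andP[N1 N2] := palette_bounds Delta a1 b_ge.
  apply: le_trans (seed_law_ge _ _ E_simple E_degree s_arrival e01 erefl erefl N1
    (palette_le a1 a16 b_ge eps_le) _).
    rewrite lee_fin lerD2l lerN2 powRr1 ?ler0n// div1r.
    exact: (tail_le_inv n2 a1 a16 b_ge b32 eps_le).
  rewrite ME; have : eps * (eps * Delta%:R) <= 1 * (eps * Delta%:R).
    by apply: ler_wpM2r; lra.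
  rewrite -/eps in N2; lra.
- exists (tape_algorithm n Delta 0 B1 B2).
  move=> E s _ _ E_simple E_degree s_arrival; split.
    move=> w; exact: (output_proper E_simple s_arrival).
  rewrite seed_law_trivial//.
    by rewrite lee_fin gerBl divr_ge0 ?powR_ge0.
  rewrite ME addSn add0n -[_.+2]addn2 natrD natrM.
  have : 10^-1 * Delta%:R <= eps * Delta%:R by apply: ler_wpM2r => //; exact: ltW.
  lra.
Qed.

Local Open Scope classical_set_scope.

Theorem theorem4p1 (R : realType) :
  exists (C c : R) (A : forall n Delta : nat, online_algorithm R n Delta),
    [/\ 0 < C, 0 < c &
      forall (n Delta : nat) (E : {set {set 'I_n}}) (s : seq {set 'I_n}),
        (2 <= n)%N -> (1 <= Delta)%N ->
        simple_graph E -> max_degree E = Delta -> arrival_order E s ->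
        (forall w : seed (A n Delta), proper_edge_coloring E (output s w)) /\
        ((1 - 1 / n%:R `^ c)%:E <=
          seed_law (A n Delta)
            [set w : seed (A n Delta) |
              ((nb_colors E (output s w))%:R <=
                Delta%:R +
                C * Delta%:R `^ (15 / 16) * ln n%:R `^ (1 / 32) :> R)%R])%E].
Proof.
pose A n Delta := projT1 (cid (exists_online_algorithm R n Delta)).
exists (30 * 100), 1, A; split => [||n Delta E s n2 D1 E_simple E_degree s_arrival].
- by rewrite mulr_gt0.
- exact: ltr01.
- exact: (projT2 (cid (exists_online_algorithm R n Delta))).
Qed.
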